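(* Let $\Lambda=\{\alpha_1,\ldots,\alpha_n\}$, $\Omega=\{\beta_1,\ldots,\beta_m\}$, $k$, and the target values $c_1,\ldots,c_n,d_1,\ldots,d_m\in\mathbb{H}$ satisfy the node assumptions (N) described in the context, and assume that $$\overline{\alpha}_i(c_i-d_i)=(c_i-d_i)\beta_i\qquad (i=1,\ldots,k).$$ With $\widetilde\alpha_s,\widetilde\beta_s$, the planes $\Pi_{\widetilde\alpha_s,\widetilde\beta_s}$ and the polynomials $\widetilde f_{\ell,i}$ ($k<i\le n$), $\widetilde f_{r,j}$ ($k<j\le m$), $\widetilde f_s$ ($1\le s\le k$) defined in the context, all polynomials $f\in\mathbb{H}[z]$ satisfying $$f^{\mathbf{e}_\ell}(\alpha_i)=c_i\quad (i=1,\ldots,n),\qquad f^{\mathbf{e}_r}(\beta_j)=d_j\quad (j=1,\ldots,m)$$ are given by the formula $$f(z)=\sum_{i=k+1}^n\widetilde f_{\ell,i}(z)+\sum_{j=k+1}^m\widetilde f_{r,j}(z)+\sum_{s=1}^k\widetilde f_s(z)+\sum_{s=1}^k P_{\Lambda_s,\ell}(z)\,\mu_s\,P_{\Omega,r}(z)+P_{\Lambda,\ell}(z)\,h(z)\,P_{\Omega,r}(z),$$ where $\mu_s\in\Pi_{\widetilde\alpha_s,\widetilde\beta_s}$ ($1\le s\le k$) and $h\in\mathbb{H}[z]$ are free parameters; that is, $f$ satisfies the interpolation conditions if and only if it is of this form for some such $\mu_s$ and $h$.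
   Context: $\mathbb{H}$ is the skew field of real quaternions, $\overline{\alpha}$ the quaternionic conjugate, $\mathrm{Re}(\alpha)$ and $\mathrm{Im}(\alpha)=\alpha-\mathrm{Re}(\alpha)$ the real and imaginary parts. $\mathbb{H}[z]$ is the ring of polynomials in a formal variable $z$ commuting with the quaternionic coefficients. For $f(z)=\sum_k z^kf_k$ and $\alpha\in\mathbb{H}$, $f^{\mathbf{e}_\ell}(\alpha)=\sum_k\alpha^kf_k$ and $f^{\mathbf{e}_r}(\alpha)=\sum_kf_k\alpha^k$ (left and right evaluations); for $f$ with real coefficients these coincide and are written $f(\alpha)$. The conjugate polynomial is $f^\sharp(z)=\sum_kz^k\overline{f_k}$; $f^\sharp f=ff^\sharp$ has real coefficients. $\alpha\sim\beta$ (equivalent) means $\alpha=h^{-1}\beta h$ for some nonzero $h\in\mathbb{H}$; $[\alpha]$ is the conjugacy class of $\alpha$. Minimal polynomials: for a finite set $S\subset\mathbb{H}$, $P_{S,\ell}$ (resp. $P_{S,r}$) is the unique monic polynomial of lowest degree whose left (resp. right) evaluation vanishes at every element of $S$; $P_{\emptyset,\ell}=P_{\emptyset,r}=1$. Put $\Lambda_i=\Lambda\setminus\{\alpha_i\}$, $\Omega_j=\Omega\setminus\{\beta_j\}$. Node assumptions (N): $\alpha_1,\ldots,\alpha_n$ are distinct quaternions, $\beta_1,\ldots,\beta_m$ are distinct quaternions ($\Lambda$ and $\Omega$ need not be disjoint), $\Omega\cap\mathbb{R}=\emptyset$; no three interpolation nodes are equivalent, i.e. $|V\cap\Lambda|+|V\cap\Omega|\le2$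 for every conjugacy class $V$; and $k\ge0$ is such that $\alpha_i\sim\beta_i$ for $1\le i\le k$, $[\alpha_i]\cap\Omega=\emptyset$ for $k<i\le n$, and $[\beta_j]\cap\Lambda=\emptyset$ for $k<j\le m$. Planes: for equivalent non-real $\alpha=x+yI$, $\beta=x+y\widetilde I$ with $x\in\mathbb{R}$, $y>0$ and $I,\widetilde I$ purely imaginary unit quaternions, $\Pi_{\alpha,\beta}$ is the real two-dimensional subspace of $\mathbb{H}\cong\mathbb{R}^4$ given by $\mathrm{span}_{\mathbb R}\{1,I\}$ if $\beta=\alpha$; $(\mathrm{span}_{\mathbb R}\{1,I\})^\perp$ if $\beta=\overline\alpha$; $\mathrm{span}_{\mathbb R}\{I+\widetilde I,\,1-I\widetilde I\}$ if $\beta\ne\alpha,\overline\alpha$. For $1\le s\le k$: $\widetilde\alpha_s=P_{\Lambda_s,\ell}^{\mathbf{e}_\ell}(\alpha_s)^{-1}\alpha_sP_{\Lambda_s,\ell}^{\mathbf{e}_\ell}(\alpha_s)$ and $\widetilde\beta_s=P_{\Omega_s,r}^{\mathbf{e}_r}(\beta_s)\beta_sP_{\Omega_s,r}^{\mathbf{e}_r}(\beta_s)^{-1}$. For $k<j\le m$: $\widetilde f_{r,j}(z)=P_{\Lambda,\ell}(z)\,\gamma_j\,P_{\Omega_j,r}(z)$, where $\gamma_j=0$ if $d_j=0$ and otherwise $$\gamma_j=(P_{\Lambda,\ell}^\sharp)^{\mathbf{e}_r}(d_j\beta_jd_j^{-1})\,d_j\,(P_{\Lambda,\ell}^\sharp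 P_{\Lambda,\ell})(\beta_j)^{-1}P_{\Omega_j,r}^{\mathbf{e}_r}(\beta_j)^{-1}.$$ For $k<i\le n$: $\widetilde f_{\ell,i}(z)=P_{\Lambda_i,\ell}(z)\,\rho_i\,P_{\Omega,r}(z)$, where $\rho_i=0$ if $c_i=0$ and otherwise $$\rho_i=P_{\Lambda_i,\ell}^{\mathbf{e}_\ell}(\alpha_i)^{-1}(P_{\Omega,r}^\sharp P_{\Omega,r})(\alpha_i)^{-1}\,c_i\,(P_{\Omega,r}^\sharp)^{\mathbf{e}_\ell}(c_i^{-1}\alpha_ic_i).$$ For $1\le s\le k$: $$\widetilde f_s(z)=P_{\Lambda_s,\ell}(z)\,\rho_s\,P_{\Omega_s,r}(z)+P_{\Lambda,\ell}(z)\,(2\,\mathrm{Im}(\widetilde\alpha_s))^{-1}(\rho_s-\gamma_s)\,P_{\Omega_s,r}(z),$$ where $\gamma_s=0$ if $d_s=0$, $\rho_s=0$ if $c_s=0$, and otherwise $$\gamma_s=(P_{\Lambda_s,\ell}^\sharp)^{\mathbf{e}_r}(d_s\beta_sd_s^{-1})\,d_s\,(P_{\Lambda_s,\ell}^\sharp P_{\Lambda_s,\ell})(\beta_s)^{-1}P_{\Omega_s,r}^{\mathbf{e}_r}(\beta_s)^{-1},$$ $$\rho_s=P_{\Lambda_s,\ell}^{\mathbf{e}_\ell}(\alpha_s)^{-1}(P_{\Omega_s,r}^\sharp P_{\Omega_s,r})(\alpha_s)^{-1}\,c_s\,(P_{\Omega_s,r}^\sharp)^{\mathbf{e}_\ell}(c_s^{-1}\alpha_sc_s).$$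 *)

(* Defs.v *)
From HB Require Import structures.
From mathcomp Require Import all_boot all_order all_algebra finmap.
From mathcomp Require Import boolp classical_sets reals.
From mathcomp Require Import ring.
Set Implicit Arguments. Unset Strict Implicit. Unset Printing Implicit Defensive.
Import Order.TTheory GRing.Theory Num.Theory.
Local Open Scope classical_set_scope.
Local Open Scope ring_scope.

(* R : realType is an arbitrary model of the real numbers. *)

(* [Quat a b c d] is the quaternion a + b i + c j + d k. *)
Record quat (R : realType) := Quat { qre : R; qi : R; qj : R; qk : R }.

Section QuaternionAlgebra.
Variable R : realType.
Implicit Types x y z : quat R.

Definition quat_to_prod x : R * R * R * R := (qre x, qi x, qj x, qk x).
Definition quat_of_prod (p : R * R * R * R) : quat R :=
  let: (a, b, c, d) := p in Quat a b c d.
Lemma quat_to_prodK : cancel quat_to_prod quat_of_prod.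
Proof. by case. Qed.

HB.instance Definition _ := Choice.copy (quat R) (can_type quat_to_prodK).

Definition zeroq : quat R := Quat 0 0 0 0.
Definition oppq x := Quat (- qre x) (- qi x) (- qj x) (- qk x).
Definition addq x y :=
  Quat (qre x + qre y) (qi x + qi y) (qj x + qj y) (qk x + qk y).

Lemma addqA : associative addq.
Proof. by move=> x y z; congr Quat => /=; ring. Qed.
Lemma addqC : commutative addq.
Proof. by move=> x y; congr Quat => /=; ring. Qed.
Lemma add0q : left_id zeroq addq.
Proof. by case=> a b c d; congr Quat => /=; ring. Qed.
Lemma addNq : left_inverse zeroq oppq addq.
Proof. by move=> x; congr Quat => /=; ring. Qed.

HB.instance Definition _ := GRing.isZmodule.Build (quat R) addqA addqC add0q addNq.

Definition oneq : quat R := Quat 1 0 0 0.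
Definition mulq x y := Quat
  (qre x * qre y - qi x * qi y - qj x * qj y - qk x * qk y)
  (qre x * qi y + qi x * qre y + qj x * qk y - qk x * qj y)
  (qre x * qj y - qi x * qk y + qj x * qre y + qk x * qi y)
  (qre x * qk y + qi x * qj y - qj x * qi y + qk x * qre y).

Lemma mulqA : associative mulq.
Proof. by move=> x y z; congr Quat => /=; ring. Qed.
Lemma mul1q : left_id oneq mulq.
Proof. by case=> a b c d; congr Quat => /=; ring. Qed.
Lemma mulq1 : right_id oneq mulq.
Proof. by case=> a b c d; congr Quat => /=; ring. Qed.
Lemma mulqDl : left_distributive mulq +%R.
Proof. by move=> x y z; congr Quat => /=; ring. Qed.
Lemma mulqDr : right_distributive mulq +%R.
Proof. by move=> x y z; congr Quat => /=; ring. Qed.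
Lemma oneq_neq0 : oneq != 0.
Proof. by apply/eqP => -[] /eqP; rewrite oner_eq0. Qed.

HB.instance Definition _ :=
  GRing.Zmodule_isNzRing.Build (quat R) mulqA mul1q mulq1 mulqDl mulqDr oneq_neq0.

Definition scaleq (a : R) x := Quat (a * qre x) (a * qi x) (a * qj x) (a * qk x).

Lemma scaleqA a b x : scaleq a (scaleq b x) = scaleq (a * b) x.
Proof. by congr Quat => /=; ring. Qed.
Lemma scale1q : left_id 1 scaleq.
Proof. by case=> a b c d; congr Quat => /=; ring. Qed.
Lemma scaleqDr : right_distributive scaleq +%R.
Proof. by move=> a x y; congr Quat => /=; ring. Qed.
Lemma scaleqDl x : {morph scaleq^~ x : a b / a + b}.
Proof. by move=> a b; congr Quat => /=; ring. Qed.

HB.instance Definition _ :=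
  GRing.Zmodule_isLmodule.Build R (quat R) scaleqA scale1q scaleqDr scaleqDl.

Lemma scaleqAl (a : R) x y : a *: (x * y) = (a *: x) * y.
Proof. by congr Quat => /=; ring. Qed.
HB.instance Definition _ := GRing.Lmodule_isLalgebra.Build R (quat R) scaleqAl.

Lemma scaleqAr (a : R) x y : a *: (x * y) = x * (a *: y).
Proof. by congr Quat => /=; ring. Qed.
HB.instance Definition _ := GRing.Lalgebra_isAlgebra.Build R (quat R) scaleqAr.

Definition quat_to_row x : 'rV[R]_4 :=
  \row_(i < 4) nth 0 [:: qre x; qi x; qj x; qk x] i.

Lemma quat_vect_axiom : Vector.axiom 4 (quat R).
Proof.
exists quat_to_row.
- move=> a x y; apply/rowP => i; rewrite !mxE.
  by case: i => [[|[|[|[|]]]]] //= _.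
- exists (fun v : 'rV[R]_4 =>
    Quat (v 0 (inord 0)) (v 0 (inord 1)) (v 0 (inord 2)) (v 0 (inord 3))).
  + by case=> a b c d; congr Quat; rewrite mxE inordK.
  + move=> v; apply/rowP => i; rewrite mxE.
    by case: i => [[|[|[|[|]]]]] //= lt_i4;
      congr (v _ _); apply/val_inj; rewrite /= inordK.
Qed.
HB.instance Definition _ := Lmodule_hasFinDim.Build R (quat R) quat_vect_axiom.

Definition conjq x := Quat (qre x) (- qi x) (- qj x) (- qk x).

(* The Euclidean inner product and norm of H, identified with R^4. *)
Definition dotq x y : R :=
  qre x * qre y + qi x * qi y + qj x * qj y + qk x * qk y.
Definition normq x : R := Num.sqrt (dotq x x).

Definition invq x := (dotq x x)^-1 *: conjq x.

Lemma dotq_eq0 x : (dotq x x == 0) = (x == 0).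
Proof.
apply/eqP/eqP => [|->]; last by rewrite /dotq /=; ring.
case: x => a b c d; rewrite /dotq /= -!expr2 => /eqP.
rewrite !paddr_eq0 ?addr_ge0 ?sqr_ge0 // !sqrf_eq0.
by case/andP=> /andP[/andP[/eqP-> /eqP->] /eqP->] /eqP->.
Qed.

Lemma mulVq : {in predC1 0, left_inverse 1 invq *%R}.
Proof.
move=> x; rewrite inE -dotq_eq0 => x0; rewrite /invq -scalerAl.
have -> : conjq x * x = dotq x x *: 1 by congr Quat; rewrite /dotq /=; ring.
by rewrite scalerA mulVf // scale1r.
Qed.
Lemma mulqV : {in predC1 0, right_inverse 1 invq *%R}.
Proof.
move=> x; rewrite inE -dotq_eq0 => x0; rewrite /invq -scalerAr.
have -> : x * conjq x = dotq x x *: 1 by congr Quat; rewrite /dotq /=; ring.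
by rewrite scalerA mulVf // scale1r.
Qed.
Lemma unitqP x y : y * x = 1 /\ x * y = 1 -> x \in predC1 0.
Proof.
case=> yx _; rewrite inE; apply/eqP => x0.
by move/eqP: yx; rewrite x0 mulr0 eq_sym oner_eq0.
Qed.
Lemma invq_out : {in [predC predC1 0], invq =1 id}.
Proof.
move=> x; rewrite !inE negbK => /eqP->; rewrite /invq.
by congr Quat => /=; ring.
Qed.
HB.instance Definition _ :=
  GRing.NzRing_hasMulInverse.Build (quat R) mulVq mulqV unitqP invq_out.

(* Re(x), seen in H, is [(qre x)%:A]. *)
Definition imq x : quat R := x - (qre x)%:A.

Definition equivq x y : Prop := exists2 h : quat R, h != 0 & x = h^-1 * y * h.
Definition conj_class x : set (quat R) := [set y | equivq y x].

End QuaternionAlgebra.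

Section Polynomials.
Variable R : realType.
Local Notation H := (quat R).
Implicit Types (f P Q : {poly H}) (S : {fset H}).

(* Polynomials over a noncommutative ring: 'X is central, and the library's
   f.[a] = \sum_i f`_i * a ^+ i is the right evaluation. *)
Definition lhorner f (a : H) : H := \sum_(i < size f) a ^+ i * f`_i.

Definition conjp f : {poly H} := map_poly (@conjq R) f.

Definition is_minpoly (ev : {poly H} -> H -> H) S P : Prop :=
  [/\ P \is monic, {in S, forall a, ev P a = 0}
    & forall Q, Q \is monic -> {in S, forall a, ev Q a = 0} ->
        (size P <= size Q)%N].

(* [xget 0] picks the unique P with the given property; existence and uniqueness
   are lminpolyP/lminpoly_uniq and rminpolyP/rminpoly_uniq below. *)
Definition lminpoly S : {poly H} := xget 0 [set P | is_minpoly lhorner S P].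
Definition rminpoly S : {poly H} := xget 0 [set P | is_minpoly horner S P].

Lemma lhorner_wide n f a :
  (size f <= n)%N -> lhorner f a = \sum_(i < n) a ^+ i * f`_i.
Proof.
move=> le_fn; rewrite /lhorner (big_ord_widen n (fun i => a ^+ i * f`_i)) //.
rewrite big_mkcond; apply: eq_bigr => i _; case: ltnP => // le_fi.
by rewrite nth_default ?mulr0.
Qed.

Lemma lhornerB f g a : lhorner (f - g) a = lhorner f a - lhorner g a.
Proof.
pose n := maxn (size f) (size g).
rewrite !(@lhorner_wide n) ?leq_maxl ?leq_maxr //; last first.
  by rewrite (leq_trans (size_polyD _ _)) // size_polyN.
by rewrite -sumrB; apply: eq_bigr => i _; rewrite coefB mulrBr.
Qed.

Lemma lhornerMC f c a : lhorner (f * c%:P) a = lhorner f a * c.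
Proof.
rewrite (@lhorner_wide (size f)); last first.
  rewrite (leq_trans (size_polyMleq _ _)) // size_polyC.
  by case: (c != 0); rewrite ?addn1 ?addn0 ?leq_pred.
by rewrite mulr_suml; apply: eq_bigr => i _; rewrite coefMC mulrA.
Qed.

Lemma lhornerMX f a : lhorner (f * 'X) a = a * lhorner f a.
Proof.
rewrite (@lhorner_wide (size f).+1); last first.
  by rewrite (leq_trans (size_polyMleq _ _)) // size_polyX addn2.
rewrite big_ord_recl coefMX /= mulr0 add0r mulr_sumr.
by apply: eq_bigr => i _; rewrite coefMX /= exprS mulrA.
Qed.

Lemma exists_minpoly (ev : {poly H} -> H -> H) S P0 :
    P0 \is monic -> {in S, forall a, ev P0 a = 0} ->
  exists P, is_minpoly ev S P.
Proof.
have [n] := ubnP (size P0); elim: n P0 => // n IHn P0 ltn mon0 van0.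
case: (pselect (is_minpoly ev S P0)) => [|nmin]; first by exists P0.
have [Q [monQ vanQ ltQ]] : exists Q,
    [/\ Q \is monic, {in S, forall a, ev Q a = 0} & (size Q < size P0)%N].
  apply: contrapT => noQ; apply: nmin; split=> // Q monQ vanQ.
  by rewrite leqNgt; apply/negP => ltQ; apply: noQ; exists Q.
by apply: (IHn Q) => //; apply: leq_trans ltQ _.
Qed.

Lemma lminpolyP S : is_minpoly lhorner S (lminpoly S).
Proof.
suff [P minP] : exists P, is_minpoly lhorner S P by exact: (xgetI 0 minP).
suff [P monP vanP] : exists2 P : {poly H}, P \is monic &
    forall a, a \in enum_fset S -> lhorner P a = 0.
  exact: (exists_minpoly monP vanP).
elim: (enum_fset S) => [|a s [P monP vanP]]; first by exists 1; rewrite ?monic1.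
pose v := lhorner P a; pose t := v^-1 * a * v.
have ev b : lhorner (P * ('X - t%:P)) b = b * lhorner P b - lhorner P b * t.
  by rewrite mulrBr lhornerB lhornerMX lhornerMC.
exists (P * ('X - t%:P)); first by rewrite monicMl ?monicXsubC.
move=> b; rewrite inE => /predU1P[->|bs]; last by rewrite ev vanP ?mulr0 ?mul0r ?subr0.
rewrite ev -/v /t; have [->|v0] := eqVneq v 0; first by rewrite mulr0 mul0r subr0.
by rewrite !mulrA divrr ?mul1r ?subrr.
Qed.

Lemma rminpolyP S : is_minpoly horner S (rminpoly S).
Proof.
suff [P minP] : exists P, is_minpoly horner S P by exact: (xgetI 0 minP).
suff [P monP vanP] : exists2 P : {poly H}, P \is monic &
    forall a, a \in enum_fset S -> P.[a] = 0.
  exact: (exists_minpoly monP vanP).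
elim: (enum_fset S) => [|a s [P monP vanP]]; first by exists 1; rewrite ?monic1.
pose v := P.[a]; pose t := v * a * v^-1.
have ev b : (('X - t%:P) * P).[b] = P.[b] * b - t * P.[b].
  by rewrite mulrBl hornerD hornerN -commr_polyX hornerMX hornerCM.
exists (('X - t%:P) * P); first by rewrite monicMr ?monicXsubC.
move=> b; rewrite inE => /predU1P[->|bs]; last by rewrite ev vanP ?mulr0 ?mul0r ?subr0.
rewrite ev -/v /t; have [->|v0] := eqVneq v 0; first by rewrite mulr0 mul0r subr0.
by rewrite -mulrA mulVr ?mulr1 ?subrr.
Qed.

Lemma size_subM P Q : P \is monic -> Q \is monic -> size P = size Q -> P != Q ->
  (size (P - Q)%R < size P)%N.
Proof.
move=> monP monQ eqs nPQ.
have P0 : (0 < size P)%N by rewrite size_poly_gt0 monic_neq0.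
rewrite -(prednK P0) ltnS; apply/leq_sizeP => i; rewrite coefB.
rewrite leq_eqVlt => /predU1P[<-|]; last first.
  by rewrite prednK // => le_i; rewrite !nth_default ?subrr -?eqs.
rewrite {2}eqs -!lead_coefE.
by move/monicP: monP => ->; move/monicP: monQ => ->; rewrite subrr.
Qed.

Lemma lminpoly_uniq S P : is_minpoly lhorner S P -> P = lminpoly S.
Proof.
case: (lminpolyP S) => monQ vanQ minQ [monP vanP minP].
have eqs : size P = size (lminpoly S) by apply/eqP; rewrite eqn_leq minP ?minQ.
apply/eqP/negPn/negP => nPQ; set r := P - lminpoly S.
have ltr := size_subM monP monQ eqs nPQ; rewrite -/r in ltr.
have r0 : lead_coef r \is a GRing.unit.
  by rewrite unfold_in /= lead_coef_eq0 subr_eq0.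
have monr : r * (lead_coef r)^-1%:P \is monic.
  apply/monicP; rewrite lead_coef_proper_mul lead_coefC divrr //.
  by rewrite oner_eq0.
have := minP _ monr _; rewrite leqNgt => /(_ _)/negP; apply.
  by move=> a aS; rewrite lhornerMC lhornerB vanP // vanQ // subr0 mul0r.
apply: leq_ltn_trans (size_polyMleq _ _) _.
by rewrite size_polyC; case: (_ != 0); rewrite ?addn1 ?addn0 // (leq_ltn_trans (leq_pred _)).
Qed.

Lemma rminpoly_uniq S P : is_minpoly horner S P -> P = rminpoly S.
Proof.
case: (rminpolyP S) => monQ vanQ minQ [monP vanP minP].
have eqs : size P = size (rminpoly S) by apply/eqP; rewrite eqn_leq minP ?minQ.
apply/eqP/negPn/negP => nPQ; set r := P - rminpoly S.
have ltr := size_subM monP monQ eqs nPQ; rewrite -/r in ltr.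
have r0 : lead_coef r \is a GRing.unit.
  by rewrite unfold_in /= lead_coef_eq0 subr_eq0.
have monr : (lead_coef r)^-1%:P * r \is monic.
  apply/monicP; rewrite lead_coef_proper_mul lead_coefC mulVr //.
  by rewrite oner_eq0.
have := minP _ monr _; rewrite leqNgt => /(_ _)/negP; apply.
  by move=> a aS; rewrite hornerCM hornerD hornerN vanP // vanQ // subr0 mulr0.
apply: leq_ltn_trans (size_polyMleq _ _) _.
by rewrite size_polyC; case: (_ != 0); rewrite ?add1n ?add0n // (leq_ltn_trans (leq_pred _)).
Qed.

End Polynomials.

Section Interpolation.
Variable R : realType.
Local Notation H := (quat R).

(* For a = x + y I with y > 0 and I an imaginary unit: y = normq (imq a), and
   [imunit a] is I. *)
Definition imunit (a : H) : H := (normq (imq a))^-1 *: imq a.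

Definition plane (a b : H) : set H :=
  let I := imunit a in let I' := imunit b in
  if b == a then [set mu | mu \in <<[:: 1%R; I]>>%VS]
  else if b == conjq a then
    [set mu | forall v : H, v \in <<[:: 1%R; I]>>%VS -> dotq mu v = 0]
  else [set mu | mu \in <<[:: (I + I')%R; (1 - I * I')%R]>>%VS].

Definition nodes n (x : 'I_n -> H) : {fset H} := [fset x i | i : 'I_n]%fset.
Definition nodes_but n (x : 'I_n -> H) (i : 'I_n) : {fset H} :=
  (nodes x `\ x i)%fset.

Definition rho (P Q : {poly H}) (a c : H) : H :=
  if c == 0 then 0 else
  (lhorner P a)^-1 * ((conjp Q * Q).[a])^-1 * c
    * lhorner (conjp Q) (c^-1 * a * c).

Definition gamma (P Q : {poly H}) (b d : H) : H :=
  if d == 0 then 0 else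
  (conjp P).[d * b * d^-1] * d * ((conjp P * P).[b])^-1 * (Q.[b])^-1.

Section Data.
Variables (n m : nat) (alpha : 'I_n -> H) (beta : 'I_m -> H).
Variables (c : 'I_n -> H) (d : 'I_m -> H).

Local Notation PL := (lminpoly (nodes alpha)).
Local Notation PO := (rminpoly (nodes beta)).
Local Notation PLi i := (lminpoly (nodes_but alpha i)).
Local Notation POj j := (rminpoly (nodes_but beta j)).

Definition alpha_tilde (i : 'I_n) : H :=
  (lhorner (PLi i) (alpha i))^-1 * alpha i * lhorner (PLi i) (alpha i).

Definition beta_tilde (j : 'I_m) : H :=
  (POj j).[beta j] * beta j * ((POj j).[beta j])^-1.

Definition f_left (i : 'I_n) : {poly H} :=
  PLi i * (rho (PLi i) PO (alpha i) (c i))%:P * PO.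

Definition f_right (j : 'I_m) : {poly H} :=
  PL * (gamma PL (POj j) (beta j) (d j))%:P * POj j.

(* The polynomial of a pair of equivalent nodes alpha i, beta j; it is used for
   i and j with the same value s < k. *)
Definition f_pair (i : 'I_n) (j : 'I_m) : {poly H} :=
  let r := rho (PLi i) (POj j) (alpha i) (c i) in
  let g := gamma (PLi i) (POj j) (beta j) (d j) in
  PLi i * r%:P * POj j
    + PL * ((2 * imq (alpha_tilde i))^-1 * (r - g))%:P * POj j.

End Data.
End Interpolation.

(* Main.v *)
Require Import Defs.
From HB Require Import structures.
From mathcomp Require Import all_boot all_order all_algebra finmap.
From mathcomp Require Import boolp classical_sets reals.
From mathcomp Require Import ring lra.
Set Implicit Arguments. Unset Strict Implicit. Unset Printing Implicit Defensive.
Import Order.TTheory GRing.Theory Num.Theory.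
Local Open Scope ring_scope.

(** The polynomials vanishing on the left nodes form the right ideal generated
    by the left minimal polynomial PL, those vanishing on the right nodes form
    the left ideal generated by the right minimal polynomial PO. Both are
    governed by the product rules: the left value of f * g at a depends on f
    only through its left value at a, the right value of f * g at b depends on
    g only through its right value at b. Conjugation of polynomials exchanges
    left and right, so only one side has to be worked out. Since conjp Q * Q
    has real coefficients, it is central, and multiplying by conjp Q cancels a
    factor Q wherever this norm polynomial does not vanish. For a minimal
    polynomial Q it vanishes only on the conjugacy classes of the nodes of Q
    (rminpoly_norm_neq0, lminpoly_norm_neq0).

    Since no class contains three nodes, a minimal polynomial of all nodes but
    one does not vanish at the remaining node (rminpoly_neq0, lminpoly_neq0).
    Hence Lagrange interpolation is available, and PL and PO are obtained from
    the smaller minimal polynomials by one linear factor, whose root is the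
    twisted node alpha_tilde or beta_tilde.

    A particular solution is the sum of the polynomials in the statement. Each
    takes its prescribed values at one node, or at one pair of equivalent
    nodes, and vanishes at the others (lhorner_rho, horner_gamma). The delicate
    case is a pair a, b. For every polynomial f the difference x between its
    left value at a and its right value at b satisfies
    conjq a * x = x * b (lhorner_sub_horner). Compatibility of the data places
    c - d in the space of these x, and this is what makes the correction term
    of the pair polynomial have the right value at b (horner_pair).

    The solution set is then governed by the homogeneous problem
    (homogeneousP). Writing a solution as q * PO and interpolating q on the
    left nodes, the left conditions separate into one condition per node. It
    forces the coefficient to vanish at an unpaired node, and at a pair it says
    that the coefficient mu satisfies alpha_tilde * mu = mu * beta_tilde. The
    solutions of this equation form the plane of the pair (planeP). *)

(** * Quaternionic conjugation and conjugacy classes *)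

Section Quaternions.
Variable R : realType.
Local Notation H := (quat R).
Implicit Types x y z a b h : H.

Lemma quat_eq x y : qre x = qre y -> qi x = qi y -> qj x = qj y ->
  qk x = qk y -> x = y.
Proof. by case: x y => [? ? ? ?] [? ? ? ?] /= -> -> -> ->. Qed.

Lemma unitqE x : (x \is a GRing.unit) = (x != 0).
Proof. by []. Qed.

Lemma mulq_eq0 x y : (x * y == 0) = (x == 0) || (y == 0).
Proof.
have [->|x0] := eqVneq x 0; first by rewrite mul0r eqxx.
apply/eqP/idP => [xy0|/eqP->]; last by rewrite mulr0.
rewrite -unitqE in x0; by rewrite -[y](mulKr x0) xy0 mulr0 eqxx.
Qed.

Lemma conjqK : involutive (@conjq R).
Proof. by move=> x; apply: quat_eq; rewrite /= ?opprK. Qed.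

Lemma conjqB : zmod_morphism (@conjq R).
Proof. by move=> x y; apply: quat_eq => /=; ring. Qed.
HB.instance Definition _ := GRing.isZmodMorphism.Build H H (@conjq R) conjqB.

Lemma conjqM x y : conjq (x * y) = conjq y * conjq x.
Proof. by apply: quat_eq => /=; ring. Qed.

Lemma conjq1 : conjq 1 = 1 :> H.
Proof. by apply: quat_eq => /=; ring. Qed.

Lemma conjq_eq0 x : (conjq x == 0) = (x == 0).
Proof. by rewrite -(inj_eq (inv_inj conjqK) x) raddf0. Qed.

Lemma conjqX x n : conjq (x ^+ n) = conjq x ^+ n.
Proof. by elim: n => [|n IH]; rewrite ?conjq1 // exprS conjqM IH -exprSr. Qed.

Lemma conjqV x : conjq x^-1 = (conjq x)^-1.
Proof.
have [->|x0] := eqVneq x 0; first by rewrite raddf0 invr0 raddf0.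
apply: (@mulrI _ (conjq x)); first by rewrite unitqE conjq_eq0.
by rewrite -conjqM mulVr ?unitqE // divrr ?conjq1 // unitqE conjq_eq0.
Qed.

Lemma conjq_real x : conjq x = x -> x = (qre x)%:A.
Proof.
case: x => a b c d [Ei Ej Ek].
by apply: quat_eq; rewrite /= ?mulr1 ?mulr0 //; lra.
Qed.

Lemma real_comm (r : R) x : r%:A * x = x * r%:A.
Proof. by rewrite -scalerAl mul1r -scalerAr mulr1. Qed.

Lemma conj_mul x : conjq x * x = (dotq x x)%:A.
Proof. by apply: quat_eq => /=; rewrite /dotq; ring. Qed.

Lemma add_conj x : x + conjq x = (2 * qre x)%:A.
Proof. by apply: quat_eq => /=; ring. Qed.

(** Boolean form of conjugacy, see equivqP: a class is the set of roots of
    X^2 - 2 Re(x) X + |x|^2 for any of its elements x. *)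
Definition same_class x y := (qre x == qre y) && (dotq x x == dotq y y).

Lemma same_class_sym x y : same_class x y = same_class y x.
Proof. by rewrite /same_class eq_sym [dotq x x == _]eq_sym. Qed.

Lemma same_class_trans y x z :
  same_class x y -> same_class y z -> same_class x z.
Proof. by rewrite /same_class => /andP[/eqP-> /eqP->]. Qed.

Lemma same_class_conj x y : same_class (conjq x) (conjq y) = same_class x y.
Proof. by rewrite /same_class /dotq /= !mulrNN. Qed.

Lemma dotqM x y : dotq (x * y) (x * y) = dotq x x * dotq y y.
Proof. by rewrite /dotq /=; ring. Qed.

Lemma same_classJ x h : h != 0 -> same_class (h^-1 * x * h) x.
Proof.
move=> h0; rewrite /same_class; apply/andP; split; apply/eqP.
  have -> : qre (h^-1 * x * h) = qre (h * (h^-1 * x)) by rewrite /=; ring.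
  by rewrite mulVKr.
rewrite !dotqM mulrAC -dotqM mulVr // /dotq /=; ring.
Qed.

(** Both sides expand to y * c * x - |x|^2 c, because y * conjq y = |y|^2 and
    x * x = 2 Re(x) x - |x|^2. Every nonzero value of c * x - conjq y * c
    therefore conjugates x to y. *)
Lemma intertwine_comm x y c : same_class x y ->
  y * (c * x - conjq y * c) = (c * x - conjq y * c) * x.
Proof.
case/andP=> /eqP Er /eqP; rewrite /dotq Er => En.
have Q : qi x * qi x = qre y * qre y + qi y * qi y + qj y * qj y
   + qk y * qk y - (qre y * qre y + qj x * qj x + qk x * qk x) by rewrite -En; ring.
by apply: quat_eq; rewrite /= Er; ring: Q.
Qed.

(** A conjugating quaternion is found among the intertwiners c * x - conjq y *
    c with c = 1, i, j. If all three vanish, then x = conjq y and x commutes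
    with i and j, so x is real and equal to y. *)
Lemma equivqP x y : equivq x y <-> same_class x y.
Proof.
split=> [[h h0 ->]|sxy]; first exact: same_classJ.
have conj_by c : c * x != conjq y * c -> equivq x y.
  rewrite -subr_eq0 => h0; exists (c * x - conjq y * c) => //.
  by rewrite -mulrA intertwine_comm // mulKr.
have [xy|/conj_by//] := eqVneq (1 * x) (conjq y * 1).
have [xyi|/conj_by//] := eqVneq (Quat 0 1 0 0 * x) (conjq y * Quat 0 1 0 0).
have [xyj|/conj_by//] := eqVneq (Quat 0 0 1 0 * x) (conjq y * Quat 0 0 1 0).
exists 1; rewrite ?oner_neq0 // invr1 mul1r mulr1.
rewrite mul1r mulr1 in xy.
rewrite -xy in xyi xyj.
have e (F : H -> R) := congr1 F xyi; have g (F : H -> R) := congr1 F xyj.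
have u (F : H -> R) := congr1 F xy.
move: (e (@qj R)) (e (@qk R)) (g (@qk R)) (u (@qi R)) (u (@qj R)) (u (@qk R)).
move: (u (@qre R)) => /=.
by move=> *; apply: quat_eq; lra.
Qed.

End Quaternions.

(** * Right evaluation over a noncommutative ring *)

Section NoncommutativeHorner.

(** The coefficients of f multiply g.[b] on the left and the powers of b stay
    on the right, so f * g and f * (g.[b])%:P have the same right value. With
    horner_mulC this gives the twisted product rule f.[v * b * v^-1] * v,
    where v = g.[b] is invertible. *)
Lemma horner_mulr (R : nzRingType) (f g : {poly R}) b :
  (f * g).[b] = (f * (g.[b])%:P).[b].
Proof.
elim/poly_ind: f => [|f c IH]; first by rewrite !mul0r.
rewrite !mulrDl -![f * 'X * _]mulrA -!commr_polyX ![f * (_ * 'X)]mulrA.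
by rewrite !hornerD !hornerMX IH -polyCM hornerC hornerCM.
Qed.

Lemma horner_XsubC_mul (R : nzRingType) t (f : {poly R}) b :
  (('X - t%:P) * f).[b] = f.[b] * b - t * f.[b].
Proof.
by rewrite mulrBl -commr_polyX hornerD hornerN hornerMX hornerCM.
Qed.

Lemma horner_mulC (R : unitRingType) (f : {poly R}) c b :
  c \is a GRing.unit -> (f * c%:P).[b] = f.[c * b * c^-1] * c.
Proof.
move=> Uc; elim/poly_ind: f => [|f e IH]; first by rewrite mul0r !horner0 mul0r.
rewrite !mulrDl -[f * 'X * _]mulrA -commr_polyX [f * (_ * 'X)]mulrA.
rewrite !hornerD !hornerMX IH -polyCM !hornerC mulrDl.
by rewrite -!mulrA mulVr ?mulr1 // !mulrA.
Qed.

Lemma horner_mulCm (R : nzRingType) (f g : {poly R}) c b :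
  (f * c%:P * g).[b] = (f * (c * g.[b])%:P).[b].
Proof. by rewrite -mulrA horner_mulr hornerCM. Qed.

Lemma horner_mul_add_XsubC (R : nzRingType) (f g : {poly R}) t r k b :
  (f * r%:P * g + f * ('X - t%:P) * k%:P * g).[b]
  = (f * (r * g.[b] + (k * g.[b] * b - t * (k * g.[b])))%:P).[b].
Proof.
rewrite -!mulrA -mulrDr horner_mulr; congr ((f * _%:P).[b]).
by rewrite hornerD horner_XsubC_mul !hornerCM -!mulrA.
Qed.

End NoncommutativeHorner.

(** * Conjugate and real polynomials *)

Section Polynomials.
Variable R : realType.
Local Notation H := (quat R).
Implicit Types (a b c t x : H) (f g N P Q r : {poly H}) (S : {fset H}).

Lemma coef_conjp f i : (conjp f)`_i = conjq f`_i.
Proof. by rewrite coef_map_id0 // raddf0. Qed.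

Lemma conjpK : involutive (@conjp R).
Proof. by move=> f; apply/polyP=> i; rewrite !coef_conjp conjqK. Qed.

Lemma conjpB : zmod_morphism (@conjp R).
Proof. by move=> f g; apply/polyP=> i; rewrite !(coefB, coef_conjp) raddfB. Qed.
HB.instance Definition _ :=
  GRing.isZmodMorphism.Build {poly H} {poly H} (@conjp R) conjpB.

Lemma conjpM f g : conjp (f * g) = conjp g * conjp f.
Proof.
apply/polyP=> i; rewrite (coef_conjp (f * g)) coefM.
rewrite (coefMr (conjp g)) (raddf_sum (@conjq R)).
by apply: eq_bigr => j _; rewrite !coef_conjp -conjqM.
Qed.

Lemma conjpC c : conjp c%:P = (conjq c)%:P.
Proof. exact: map_polyC. Qed.

Lemma conjpX : conjp 'X = 'X :> {poly H}.
Proof.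
by apply/polyP=> i; rewrite coef_conjp coefX; case: eqP; rewrite ?conjq1 ?raddf0.
Qed.

Lemma conjpXsubC c : conjp ('X - c%:P) = 'X - (conjq c)%:P.
Proof. by rewrite raddfB /= conjpX conjpC. Qed.

Lemma size_conjp f : size (conjp f) = size f.
Proof.
have [->|f0] := eqVneq f 0; first by rewrite raddf0.
by rewrite size_poly_eq // conjq_eq0 lead_coef_eq0.
Qed.

Lemma monic_conjp f : (conjp f \is monic) = (f \is monic).
Proof.
rewrite !monicE !lead_coefE size_conjp coef_conjp -{1}(@conjq1 R).
by rewrite (inj_eq (inv_inj (@conjqK R))).
Qed.

(** Conjugation reverses products, hence exchanges the two evaluations. Left-
    handed facts are obtained from right-handed ones through this identity. *)
Lemma lhornerE f a : lhorner f a = conjq (conjp f).[conjq a].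
Proof.
rewrite horner_coef size_conjp raddf_sum; apply: eq_bigr => i _.
by rewrite /= coef_conjp conjqM conjqX !conjqK.
Qed.

Lemma hornerE_conj f a : f.[a] = conjq (lhorner (conjp f) (conjq a)).
Proof. by rewrite lhornerE !(conjqK, conjpK). Qed.

Lemma lhorner0 a : lhorner 0 a = 0.
Proof. by rewrite /lhorner size_poly0 big_ord0. Qed.

Lemma lhorner_mull f g a : lhorner (f * g) a = lhorner ((lhorner f a)%:P * g) a.
Proof. by rewrite !lhornerE !conjpM horner_mulr conjpC conjqK. Qed.

Lemma horner_mulr0 f g b : g.[b] = 0 -> (f * g).[b] = 0.
Proof. by move=> g0; rewrite horner_mulr g0 mulr0 horner0. Qed.

Lemma lhorner_mull0 f g a : lhorner f a = 0 -> lhorner (f * g) a = 0.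
Proof. by move=> f0; rewrite lhorner_mull f0 mul0r lhorner0. Qed.

Lemma lhorner_Cmul f c a : c != 0 ->
  lhorner (c%:P * f) a = c * lhorner f (c^-1 * a * c).
Proof.
move=> c0; rewrite !lhornerE conjpM conjpC horner_mulC ?unitqE ?conjq_eq0 //.
by rewrite conjqM conjqK !conjqM conjqV mulrA.
Qed.

Lemma lhorner_comm_Cmul f c a : a * c = c * a ->
  lhorner (c%:P * f) a = c * lhorner f a.
Proof.
have [->|c0] := eqVneq c 0 => ac.
  by rewrite !mul0r lhorner0.
by rewrite lhorner_Cmul // -mulrA ac mulKr.
Qed.

Lemma horner_comm_mulC f c b : b * c = c * b ->
  (f * c%:P).[b] = f.[b] * c.
Proof.
by move=> bc; rewrite hornerM_comm ?hornerC // /comm_poly hornerC.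
Qed.

(** Such polynomials have real coefficients, so they are central and are the
    ones on which the two evaluations agree. *)
Definition realp f := conjp f = f.

Lemma realp_comm f g : realp f -> f * g = g * f.
Proof.
move=> rf; apply/polyP=> i; rewrite coefM coefMr; apply: eq_bigr => j _.
have/conjq_real-> : conjq f`_j = f`_j by rewrite -coef_conjp rf.
exact: real_comm.
Qed.

Lemma realp_comm_poly f b : realp f -> comm_poly f b.
Proof.
move=> rf; rewrite /comm_poly -hornerCM -realp_comm // hornerM_comm ?hornerC //.
by rewrite /comm_poly hornerC.
Qed.

Lemma lhorner_real f a : realp f -> lhorner f a = f.[a].
Proof.
move=> rf; rewrite horner_coef; apply: eq_bigr => i _.
have/conjq_real-> : conjq f`_i = f`_i by rewrite -coef_conjp rf.
by rewrite real_comm.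
Qed.

Lemma realpM f g : realp f -> realp g -> realp (f * g).
Proof. by move=> rf rg; rewrite /realp conjpM rf rg realp_comm. Qed.

Lemma realp1 : realp 1.
Proof. by rewrite /realp -polyC1 conjpC conjq1. Qed.

Lemma horner_realM f r b : realp r -> (f * r).[b] = f.[b] * r.[b].
Proof. by move=> rr; rewrite hornerM_comm //; exact: realp_comm_poly. Qed.

Lemma realp_conj_mul f : realp (conjp f * f).
Proof. by rewrite /realp conjpM conjpK. Qed.

Lemma conj_mulC f : f \is monic -> f * conjp f = conjp f * f.
Proof.
move=> mf; apply: (monic_rreg mf) => /=.
by rewrite -mulrA (realp_comm f (realp_conj_mul f)).
Qed.

(** The real polynomial X^2 - 2 Re(a) X + |a|^2, whose roots form the
    conjugacy class of a. *)
Definition class_poly a : {poly H} := conjp ('X - a%:P) * ('X - a%:P).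

Lemma horner_class_poly a b : (class_poly a).[b] = (b - a) * b - conjq a * (b - a).
Proof.
by rewrite /class_poly conjpXsubC horner_XsubC_mul hornerXsubC.
Qed.

(** The imaginary part of class_poly a at b is 2 (Re b - Re a) Im b. If
    the real parts agree, the value is |a|^2 - |b|^2. Otherwise a root b would
    be real, but then the value is (b - Re a)^2 + |Im a|^2 > 0. *)
Lemma root_class_poly a b : same_class a b = ((class_poly a).[b] == 0).
Proof.
rewrite horner_class_poly; apply/idP/eqP => [/andP[/eqP Er /eqP]|].
  rewrite /dotq Er => En.
  have Q : qi a * qi a = qi b * qi b + qj b * qj b
   + qk b * qk b - (qj a * qj a + qk a * qk a).
    by lra.
  by apply: quat_eq; rewrite /= Er; ring: Q.
move=> e; have {}e (F : H -> R) := congr1 F e.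
move: (e (@qre R)) (e (@qi R)) (e (@qj R)) (e (@qk R)) => {e} /=.
rewrite /same_class /dotq.
case: a b => [a0 a1 a2 a3] [b0 b1 b2 b3] /= e0 e1 e2 e3.
have h1 : (b0 - a0) * b1 = 0 by lra.
have h2 : (b0 - a0) * b2 = 0 by lra.
have h3 : (b0 - a0) * b3 = 0 by lra.
have [E|ne] := eqVneq a0 b0.
  by rewrite E in e0 *; apply/andP; split; apply/eqP => //; lra.
have n0 : b0 - a0 != 0 by rewrite subr_eq0 eq_sym.
have z y : (b0 - a0) * y = 0 -> y = 0.
  by move/eqP; rewrite mulf_eq0 (negPf n0) => /eqP.
rewrite (z _ h1) (z _ h2) (z _ h3) in e0.
exfalso; have : 0 < (b0 - a0) ^+ 2 by rewrite exprn_even_gt0.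
have := sqr_ge0 a1; have := sqr_ge0 a2; have := sqr_ge0 a3.
nra.
Qed.

(** The product of the class polynomials of those elements of s that are not
    conjugate to b; it serves to show that evaluations at b do not vanish. *)
Lemma real_separator (s : seq H) b :
  exists r, [/\ realp r, r.[b] != 0
    & {in s, forall a, ~~ same_class a b -> r.[a] = 0}].
Proof.
elim: s => [|a s [r [rr rb rs]]].
  by exists 1; split; rewrite ?hornerC ?oner_neq0 //; exact: realp1.
have [sab|nab] := boolP (same_class a b).
  exists r; split=> // x; rewrite inE => /predU1P[->|]; last exact: rs.
  by rewrite sab.
exists (r * class_poly a); split.
- by apply: realpM => //; exact: realp_conj_mul.
- rewrite horner_realM; last exact: realp_conj_mul.
  by rewrite mulq_eq0 negb_or rb -root_class_poly.
- move=> x; rewrite inE horner_realM; last exact: realp_conj_mul.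
  case/predU1P => [-> _|xs nx]; last by rewrite (rs x xs nx) mul0r.
  by rewrite horner_class_poly subrr mul0r mulr0 subrr mulr0.
Qed.

End Polynomials.

(** * Minimal polynomials for right evaluation *)

Section RightMinimal.
Variable R : realType.
Local Notation H := (quat R).
Implicit Types (a b c t x : H) (f g N P Q r : {poly H}) (S : {fset H}).

Lemma rminpoly_monic S : rminpoly S \is monic.
Proof. by case: (rminpolyP S). Qed.

Lemma rminpoly_root S : {in S, forall a, (rminpoly S).[a] = 0}.
Proof. by case: (rminpolyP S). Qed.

(** The remainder of the division by the monic minimal polynomial vanishes on
    S and is too short to be nonzero. In this form the minimal polynomial
    generates the left ideal of polynomials vanishing on S. *)
Lemma rminpoly_dvd S f :
  {in S, forall a, f.[a] = 0} -> exists q, f = q * rminpoly S.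
Proof.
have [monP vanP minP] := rminpolyP S; set P := rminpoly S in monP vanP minP *.
move=> vanf; exists (Pdiv.Ring.rdivp f P).
have ef := Pdiv.RingMonic.rdivp_eq monP f.
set r := Pdiv.Ring.rmodp f P in ef.
have ltr : (size r < size P)%N by rewrite Pdiv.Ring.ltn_rmodpN0 ?monic_neq0.
have [r0|r0] := eqVneq r 0; first by rewrite {1}ef r0 addr0.
have vanr : {in S, forall a, r.[a] = 0}.
  move=> a aS; have := vanf a aS; rewrite ef hornerD horner_mulr0 ?add0r //.
  exact: vanP.
have u : lead_coef r \is a GRing.unit by rewrite unitqE lead_coef_eq0.
have monr : (lead_coef r)^-1%:P * r \is monic.
  apply/monicP; rewrite lead_coef_proper_mul lead_coefC mulVr //.
  exact: oner_neq0.
have vanr' : {in S, forall a, ((lead_coef r)^-1%:P * r).[a] = 0}.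
  by move=> a aS; rewrite hornerCM vanr // mulr0.
have := minP _ monr vanr'; rewrite leqNgt => /negP[].
rewrite (leq_ltn_trans (size_polyMleq _ _)) // size_polyC.
by case: (_ != 0); rewrite ?add1n ?add0n // (leq_ltn_trans (leq_pred _)).
Qed.

(** By rminpoly_dvd it suffices to find one polynomial that vanishes on S but
    not at b: a real separator handles the other classes, and a factor X - x
    handles the single x of S in the class of b. Two such elements x would
    force the whole class to be zeros. *)
Lemma rminpoly_neq0 S b : b \notin S ->
    {in S &, forall x y, same_class x b -> same_class y b -> x = y} ->
  (rminpoly S).[b] != 0.
Proof.
move=> bS uS; have [r [rr rb rs]] := real_separator (enum_fset S) b.
suff [g gb gS] : exists2 g, g.[b] != 0 & {in S, forall a, g.[a] = 0}.
  have [q eg] := rminpoly_dvd gS; apply: contraNneq gb => P0.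
  by rewrite eg horner_mulr0.
have [/hasP[x xS xb]|/hasPn nS] :=
  boolP (has (fun x => same_class x b) (enum_fset S)).
  exists (('X - x%:P) * r).
    rewrite horner_realM // hornerXsubC mulq_eq0 negb_or rb subr_eq0 andbT.
    by apply: contraNneq bS => ->.
  move=> a aS; rewrite horner_realM // hornerXsubC.
  have [ab|ab] := boolP (same_class a b); last by rewrite (rs a aS ab) mulr0.
  by rewrite (uS a x) // subrr mul0r.
by exists r => // a aS; apply: rs => //; exact: nS.
Qed.

(** A real separator r is q * Q with Q minimal, so r^2 = conjp r * r = (conjp
    q * q) * (conjp Q * Q) since conjp q * q is central. As r.[b] is nonzero,
    so is the value of conjp Q * Q. *)
Lemma rminpoly_norm_neq0 S b : {in S, forall a, ~~ same_class a b} ->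
  (conjp (rminpoly S) * rminpoly S).[b] != 0.
Proof.
move=> nS; have [r [rr rb rs]] := real_separator (enum_fset S) b.
have [a aS|q er] := @rminpoly_dvd S r; first by apply: rs => //; exact: nS.
set Q := rminpoly S in er *.
have e2 : r * r = (conjp q * q) * (conjp Q * Q).
  rewrite -{1}rr {1 2}er conjpM [LHS]mulrA -[X in X * Q]mulrA.
  by rewrite -(realp_comm _ (realp_conj_mul q)) mulrA.
have : (r * r).[b] != 0 by rewrite horner_realM // mulq_eq0 negb_or rb.
apply: contraNneq => N0.
by rewrite e2 horner_realM ?N0 ?mulr0 //; exact: realp_conj_mul.
Qed.

(** By the product rule, multiplying by X - t kills b exactly for t = v * b *
    v^-1, and a shorter multiple of rminpoly S would be a constant multiple of
    it, nonzero at b. *)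
Lemma rminpolyU1 S b : let v := (rminpoly S).[b] in v != 0 ->
  rminpoly (b |` S)%fset = ('X - (v * b * v^-1)%:P) * rminpoly S.
Proof.
move=> v v0; set P := rminpoly S; have mP : P \is monic := rminpoly_monic S.
apply: esym; apply: rminpoly_uniq; split.
- by rewrite (monicMl _ (monicXsubC _)).
- move=> a; rewrite in_fset1U => /predU1P[->|aS]; last first.
    by rewrite horner_mulr0 //; exact: rminpoly_root.
  rewrite horner_mulr horner_mulC ?unitqE // hornerXsubC.
  by rewrite subrr mul0r.
move=> f mf vf; have [a aS|q ef] := @rminpoly_dvd S f.
  by apply: vf; rewrite in_fset1U aS orbT.
have q0 : q != 0.
  apply: contraTneq mf => q0.
  by rewrite ef q0 mul0r monicE lead_coef0 eq_sym oner_eq0.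
rewrite ef (size_monicM (monicXsubC _) (monic_neq0 mP)) (size_Mmonic q0 mP).
rewrite size_XsubC -!subn1 leq_sub2r // leq_add2r.
rewrite ltnNge; apply/negP => /size1_polyC eq.
have := vf b; rewrite in_fset1U eqxx => /(_ isT)/eqP.
rewrite ef eq hornerCM mulq_eq0 (negPf v0) orbF => /eqP z.
by rewrite eq z polyC0 eqxx in q0.
Qed.

End RightMinimal.

(** * Minimal polynomials for left evaluation *)

Section LeftMinimal.
Variable R : realType.
Local Notation H := (quat R).
Implicit Types (a b c t x : H) (f g N P Q r : {poly H}) (S : {fset H}).

Lemma realp_horner_conj f b : realp f -> f.[conjq b] = conjq f.[b].
Proof. by move=> rf; rewrite hornerE_conj rf conjqK lhorner_real. Qed.

Definition conj_fset S := [fset conjq x | x in S]%fset.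

Lemma mem_conj_fset S a : (conjq a \in conj_fset S) = (a \in S).
Proof.
apply/imfsetP/idP => [[x xS /(inv_inj (@conjqK R))->]//|aS].
by exists a.
Qed.

(** Conjugation exchanges left zeros of f on S with right zeros of conjp f on
    the conjugates of S. *)
Lemma lminpoly_conj S : lminpoly S = conjp (rminpoly (conj_fset S)).
Proof.
have [mP vP minP] := rminpolyP (conj_fset S).
apply: esym; apply: lminpoly_uniq; split.
- by rewrite monic_conjp.
- by move=> a aS; rewrite lhornerE conjpK vP ?mem_conj_fset // raddf0.
move=> f mf vf; rewrite size_conjp -(size_conjp f) minP ?monic_conjp //.
move=> a; rewrite -(conjqK a) mem_conj_fset => aS.
by rewrite hornerE_conj conjpK conjqK vf // raddf0.
Qed.

Lemma lminpoly_monic S : lminpoly S \is monic.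
Proof. by rewrite lminpoly_conj monic_conjp rminpoly_monic. Qed.

Lemma lminpoly_root S : {in S, forall a, lhorner (lminpoly S) a = 0}.
Proof. by case: (lminpolyP S). Qed.

Lemma lminpoly_dvd S f :
  {in S, forall a, lhorner f a = 0} -> exists q, f = lminpoly S * q.
Proof.
move=> vf; have [a|q eq] := @rminpoly_dvd R (conj_fset S) (conjp f).
  rewrite -{1}(conjqK a) mem_conj_fset => aS.
  by rewrite hornerE_conj conjpK vf // raddf0.
by exists (conjp q); rewrite -(conjpK f) eq conjpM lminpoly_conj.
Qed.

Lemma lminpoly_neq0 S b : b \notin S ->
    {in S &, forall x y, same_class x b -> same_class y b -> x = y} ->
  lhorner (lminpoly S) b != 0.
Proof.
move=> bS uS; rewrite lhornerE lminpoly_conj conjpK conjq_eq0.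
rewrite rminpoly_neq0 ?mem_conj_fset //.
move=> x y; rewrite -(conjqK x) -(conjqK y) !mem_conj_fset !same_class_conj.
by move=> xS yS xb yb; rewrite (uS (conjq x) (conjq y)).
Qed.

Lemma lminpoly_norm_neq0 S b : {in S, forall a, ~~ same_class a b} ->
  (conjp (lminpoly S) * lminpoly S).[b] != 0.
Proof.
move=> nS; rewrite lminpoly_conj conjpK conj_mulC ?rminpoly_monic //.
rewrite -[b]conjqK realp_horner_conj ?conjq_eq0; last exact: realp_conj_mul.
apply: rminpoly_norm_neq0 => a; rewrite -(conjqK a) mem_conj_fset same_class_conj.
exact: nS.
Qed.

Lemma lminpolyU1 S b : let p := lhorner (lminpoly S) b in p != 0 ->
  lminpoly (b |` S)%fset = lminpoly S * ('X - (p^-1 * b * p)%:P).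
Proof.
move=> p p0.
have -> : lminpoly (b |` S)%fset = conjp (rminpoly (conjq b |` conj_fset S)%fset).
  rewrite lminpoly_conj; congr (conjp (rminpoly _)); apply/fsetP=> x.
  rewrite -(conjqK x) mem_conj_fset !in_fset1U mem_conj_fset.
  by rewrite (inj_eq (inv_inj (@conjqK R))).
have ev : (rminpoly (conj_fset S)).[conjq b] = conjq p.
  by rewrite /p lhornerE lminpoly_conj conjpK conjqK.
rewrite rminpolyU1 ev ?conjq_eq0 // conjpM conjpXsubC lminpoly_conj.
by rewrite !conjqM -conjqV !conjqK mulrA.
Qed.

End LeftMinimal.

(** * The planes as spaces of intertwiners *)

Section Planes.
Variable R : realType.
Local Notation H := (quat R).
Implicit Types (a b x mu : H).

Lemma span2P (p q mu : H) :
  mu \in <<[:: p; q]>>%VS <-> exists s t : R, mu = s *: p + t *: q.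
Proof.
rewrite span_cons span_seq1; split.
  by case/memv_addP=> _ /vlineP[s ->] [_ /vlineP[t ->] ->]; exists s, t.
by case=> s [t ->]; rewrite memv_add // memvZ // memv_line.
Qed.

Lemma imqE a : imq a = Quat 0 (qi a) (qj a) (qk a).
Proof. by apply: quat_eq => /=; ring. Qed.

Lemma imq_conj a : 2 * imq a = a - conjq a.
Proof. by rewrite imqE; apply: quat_eq => /=; ring. Qed.

Lemma normq_im_gt0 a : imq a != 0 -> 0 < Defs.normq (imq a).
Proof.
move=> a0; rewrite /Defs.normq sqrtr_gt0 lt0r dotq_eq0 a0 /dotq.
by rewrite !addr_ge0 // -expr2 sqr_ge0.
Qed.

Lemma normq_sqr x : Defs.normq x * Defs.normq x = dotq x x.
Proof.
by rewrite -expr2 sqr_sqrtr // /dotq !addr_ge0 // -expr2 sqr_ge0.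
Qed.

Lemma imunitE a : imq a != 0 ->
  a = (qre a)%:A + Defs.normq (imq a) *: imunit a.
Proof.
move=> a0; rewrite /imunit scalerA divff ?scale1r ?gt_eqF ?normq_im_gt0 //.
by rewrite addrC subrK.
Qed.

Lemma qre_imunit a : qre (imunit a) = 0.
Proof. by rewrite /imunit imqE /= mulr0. Qed.

Lemma imunit_sqr a : imq a != 0 -> imunit a * imunit a = -1.
Proof.
move=> a0; rewrite /imunit -scalerAl -scalerAr scalerA -invfM normq_sqr.
have -> : imq a * imq a = - (dotq (imq a) (imq a))%:A.
  by rewrite imqE /dotq; apply: quat_eq => /=; ring.
by rewrite scalerN scalerA mulVf ?scale1r // dotq_eq0.
Qed.

Lemma same_class_im a b : same_class a b ->
  Defs.normq (imq a) = Defs.normq (imq b) /\ (imq a == 0) = (imq b == 0).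
Proof.
case/andP=> /eqP Er /eqP En.
have E : dotq (imq a) (imq a) = dotq (imq b) (imq b).
  rewrite !imqE; move: En; rewrite /dotq Er /=; lra.
by rewrite /Defs.normq -!dotq_eq0 E.
Qed.

(** x - u * x * u is twice the orthogonal projection of x on the span of 1 and
    u; it equals 2 * x when x commutes with u. *)
Lemma unit_commute (u x : H) : qre u = 0 -> u * u = -1 ->
  u * x = x * u -> exists s t : R, x = s *: 1 + t *: u.
Proof.
move=> u0 uu ux; exists (qre x), (dotq x u).
have -> : qre x *: 1 + dotq x u *: u = 2^-1 *: (x - u * x * u).
  have := congr1 (@qre R) uu.
  rewrite /dotq; move: u0 {ux uu}; case: u x => [u0 u1 u2 u3] [x0 x1 x2 x3] /= -> uu.
  have Q : u1 * u1 = 1 - u2 * u2 - u3 * u3 by lra.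
  by apply: quat_eq => /=; field: Q.
rewrite ux -mulrA uu mulrN1 opprK -mulr2n -scaler_nat scalerA.
by rewrite mulVf ?scale1r // pnatr_eq0.
Qed.

(** For purely imaginary u, u * x + x * u = 2 (Re(x) u - (x . u)), so
    anticommuting means that x is orthogonal to 1 and u. *)
Lemma unit_anticommute (u x : H) : qre u = 0 -> u * u = -1 ->
  (u * x = - (x * u)) <-> (dotq x 1 = 0 /\ dotq x u = 0).
Proof.
move=> u0 uu.
have -> : (u * x = - (x * u)) <-> qre x *: u = (dotq x u)%:A.
  have e : u * x + x * u = 2 *: (qre x *: u - (dotq x u)%:A).
    move: u0; case: u {uu} x => [u0 ? ? ?] [? ? ? ?] /= ->.
    by apply: quat_eq => /=; rewrite /dotq /=; ring.
  split=> [h|h].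
    move: e; rewrite h addNr => /esym/eqP; rewrite scaler_eq0 pnatr_eq0 /= subr_eq0.
    by move/eqP.
  by apply/eqP; rewrite -addr_eq0 e h subrr scaler0.
have -> : dotq x 1 = qre x by rewrite /dotq /=; ring.
split=> [h|[-> ->]]; last by rewrite !scale0r.
have d0 : dotq x u = 0.
  by have := congr1 (@qre R) h; rewrite /= u0 mulr0 mulr1.
split=> //; move: h; rewrite d0 scale0r => /eqP; rewrite scaler_eq0.
case/orP=> [/eqP//|/eqP u00]; move: uu; rewrite u00 mul0r => /eqP.
by rewrite eq_sym oppr_eq0 oner_eq0.
Qed.

Lemma commute_im (r y : R) (u u' mu : H) : y != 0 ->
  (r%:A + y *: u) * mu = mu * (r%:A + y *: u') <-> u * mu = mu * u'.
Proof.
move=> y0; rewrite mulrDl mulrDr real_comm -[y *: u * mu]scalerAl.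
rewrite -[mu * (y *: u')]scalerAr; split=> [/addrI h|->//].
move/(congr1 ( *:%R y^-1)): h.
by rewrite !scalerA mulVf // !scale1r.
Qed.

(** The three cases in the definition of the plane describe a single space:
    the solutions of a * mu = mu * b. For equivalent a and b only the
    imaginary units I and I' matter. If I' = I these solutions form the
    commutant of I, and if I' = - I its orthogonal complement. Otherwise m = 1
    - I * I' is an invertible solution, every other one is m multiplied on the
    left by an element of the commutant of I, and I * m = I + I'. *)
Lemma planeP a b mu : same_class a b -> imq a != 0 ->
  plane a b mu <-> a * mu = mu * b.
Proof.
move=> sab a0; have [En Ez] := same_class_im sab.
have b0 : imq b != 0 by rewrite -Ez.
have y0 : Defs.normq (imq a) != 0 by rewrite gt_eqF ?normq_im_gt0.
have /andP[/eqP Er _] := sab.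
have -> : (a * mu = mu * b) <-> (imunit a * mu = mu * imunit b).
  by rewrite {1}(imunitE a0) {1}(imunitE b0) -Er -En commute_im.
have [ua ub] := (imunit_sqr a0, imunit_sqr b0).
have u0 := qre_imunit a.
have same_unit : b = a -> imunit b = imunit a by move->.
have conj_unit : b = conjq a <-> imunit b = - imunit a.
  split=> [eb|eI]; first by rewrite /imunit -En eb imqE; apply: quat_eq => /=; ring.
  rewrite (imunitE a0) (imunitE b0) -Er -En eI.
  by apply: quat_eq; rewrite /= ?u0; ring.
rewrite /plane /=.
move: (imunit a) (imunit b) u0 ua ub same_unit conj_unit => I I' u0 ua ub sI cI.
case: (eqVneq b a) => [/sI->|_].
  rewrite /mkset /= span2P; split=> [[s [t ->]]|]; last exact: unit_commute.
  by rewrite mulrDr mulrDl -!scalerAr -!scalerAl mul1r mulr1.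
case: (eqVneq b (conjq a)) => [/cI->|/eqP nb].
  rewrite mulrN unit_anticommute //; split=> /= [h|[h1 hu] v].
    split; apply: h; apply/span2P; [exists 1, 0|exists 0, 1];
      by rewrite ?scale1r ?scale0r ?add0r ?addr0.
  case/span2P => s [t ->].
  have -> : dotq mu (s *: 1 + t *: I) = s * dotq mu 1 + t * dotq mu I.
    by rewrite /dotq /=; ring.
  by rewrite h1 hu !mulr0 addr0.
have e1 : I * (1 - I * I') = I + I'.
  by rewrite mulrBr mulr1 mulrA ua mulN1r opprK.
have e2 : (1 - I * I') * I' = I + I'.
  by rewrite mulrBl mul1r -mulrA ub mulrN1 opprK addrC.
rewrite /mkset /= span2P; split=> [[s [t ->]]|h].
  rewrite mulrDr mulrDl -!scalerAr -!scalerAl e1 e2; congr (s *: _ + _).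
  by rewrite mulrDr mulrDl ua ub addrC.
set m := 1 - I * I' in e1 e2 *.
have m0 : m \is a GRing.unit.
  rewrite unitqE; apply/eqP => m0; apply/nb/cI.
  by apply/eqP; rewrite -addr_eq0 addrC -e1 m0 mulr0.
have [|s [t E]] := @unit_commute I (mu * m^-1) u0 ua.
  by rewrite mulrA h; apply: (mulIr m0); rewrite mulrVK // -!mulrA e1 -e2 mulKr.
exists t, s; rewrite -[mu](mulrVK m0) E mulrDl -!scalerAl mul1r e1.
by rewrite addrC.
Qed.

End Planes.

(** * One-node interpolants *)

Section Interpolants.
Variable R : realType.
Local Notation H := (quat R).
Implicit Types (a b c d t x : H) (f g P Q : {poly H}).

Lemma lhornerD f g a : lhorner (f + g) a = lhorner f a + lhorner g a.
Proof. by rewrite !lhornerE raddfD /= hornerD raddfD. Qed.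

Lemma lhornerC c a : lhorner c%:P a = c.
Proof. by rewrite lhornerE conjpC hornerC conjqK. Qed.

Lemma lhorner_sum (I : Type) (s : seq I) (p : pred I) (F : I -> {poly H}) a :
  lhorner (\sum_(i <- s | p i) F i) a = \sum_(i <- s | p i) lhorner (F i) a.
Proof.
by apply: (big_morph (fun f => lhorner f a)) => [f g|];
  rewrite ?lhornerD ?lhorner0.
Qed.

Lemma commrV_real f a : realp f -> a * (f.[a])^-1 = (f.[a])^-1 * a.
Proof. by move=> rf; apply: commrV; exact: realp_comm_poly. Qed.

(** The norm polynomial is real, hence central. *)
Lemma lhorner_norm_mul Q a c :
  lhorner (c%:P * (conjp Q * Q)) a = (conjp Q * Q).[a] * c.
Proof.
have rN := realp_conj_mul Q.
by rewrite -(realp_comm _ rN) lhornerMC lhorner_real.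
Qed.

Lemma rhoE P Q a c :
  rho P Q a c = (lhorner P a)^-1 * ((conjp Q * Q).[a])^-1
                * lhorner (c%:P * conjp Q) a.
Proof.
rewrite /rho; have [->|c0] := eqVneq c 0; first by rewrite mul0r lhorner0 mulr0.
by rewrite lhorner_Cmul // mulrA.
Qed.

Lemma gammaE P Q b d :
  gamma P Q b d = (conjp P * d%:P).[b] * ((conjp P * P).[b])^-1 * (Q.[b])^-1.
Proof.
rewrite /gamma; have [->|d0] := eqVneq d 0; first by rewrite mulr0 horner0 !mul0r.
by rewrite horner_mulC ?unitqE.
Qed.

(** The value rho is chosen so that, after removing the factor P, the constant
    in front of Q is the left value at a of c%:P * conjp Q, divided by the
    norm of Q at a. Multiplying by Q then produces the left value of c%:P *
    conjp Q * Q, which is the norm times c. *)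
Lemma lhorner_rho P Q a c : Q \is monic -> lhorner P a != 0 ->
  (conjp Q * Q).[a] != 0 -> lhorner (P * (rho P Q a c)%:P * Q) a = c.
Proof.
rewrite -!unitqE => mQ Up UN.
rewrite -(mulrA P) lhorner_mull (mulrA _%:P) -polyCM.
rewrite rhoE -(mulrA (_^-1)) (mulVKr Up) polyCM -(mulrA (_^-1)%:P).
rewrite (lhorner_comm_Cmul (_ * Q)); last first.
  by apply: commrV_real; exact: realp_conj_mul.
by rewrite -lhorner_mull -(mulrA c%:P) lhorner_norm_mul (mulKr UN).
Qed.

(** Mirror image of lhorner_rho, with the norm of P at b. *)
Lemma horner_gamma P Q b d : P \is monic -> Q.[b] != 0 ->
  (conjp P * P).[b] != 0 -> (P * (gamma P Q b d)%:P * Q).[b] = d.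
Proof.
rewrite -!unitqE => mP Uv UN; rewrite horner_mulr -(mulrA P) -polyCM gammaE.
rewrite (mulrVK Uv) polyCM (mulrA P) (horner_comm_mulC (P * _)); last first.
  by apply: commrV_real; exact: realp_conj_mul.
rewrite -horner_mulr (mulrA P) conj_mulC // (realp_comm _ (realp_conj_mul P)).
by rewrite hornerCM (mulrK UN).
Qed.

(** Multiplying further by conjp Q turns g * Q into a real polynomial times g,
    with a nonzero value at a. *)
Lemma lhorner_cancelr Q a g : Q \is monic -> (conjp Q * Q).[a] != 0 ->
  lhorner (g * Q) a = 0 -> lhorner g a = 0.
Proof.
move=> mQ N0 /(@lhorner_mull0 _ _ (conjp Q) _).
rewrite -mulrA conj_mulC // lhorner_mull lhorner_norm_mul => /eqP.
by rewrite mulq_eq0 (negPf N0) => /eqP.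
Qed.

(** For equivalent a and b these are the possible discrepancies between a left
    value at a and a right value at b (lhorner_sub_horner); this is where the
    compatibility condition comes from. *)
Definition twisted a b : {pred H} := fun x => conjq a * x == x * b.

Lemma twistedB a b x y :
  x \in twisted a b -> y \in twisted a b -> x - y \in twisted a b.
Proof.
by rewrite !unfold_in => /eqP xT /eqP yT; rewrite mulrBr mulrBl xT yT.
Qed.

(** Each term a^i f_i - f_i b^i has the form a * x - x * b. The operator x |->
    conjq a * x - x * b annihilates these, because its composite with x |-> a
    * x - x * b is right multiplication by the real polynomial that a and b
    both satisfy. The induction carries this out one coefficient at a time. *)
Lemma lhorner_sub_horner f a b : same_class a b ->
  lhorner f a - f.[b] \in twisted a b.
Proof.
move=> /andP[/eqP Er /eqP En]; rewrite unfold_in.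
elim/poly_ind: f => [|f e IH].
  by rewrite lhorner0 horner0 subr0 mulr0 mul0r.
have -> : lhorner (f * 'X + e%:P) a - (f * 'X + e%:P).[b]
          = a * lhorner f a - f.[b] * b.
  rewrite lhornerD lhornerMX lhornerC hornerD hornerMX hornerC.
  by rewrite opprD addrACA subrr addr0.
move: (lhorner f a) (f.[b]) IH => L r /eqP.
rewrite mulrBr mulrBl => IH.
have e1 : conjq a * r = conjq a * L - (L * b - r * b) by rewrite -IH subKr.
have e2 : conjq a * a * L = L * (conjq b * b).
  by rewrite !conj_mul En real_comm.
have e3 : a * L = L * b + L * conjq b - conjq a * L.
  by apply/eqP; rewrite eq_sym subr_eq -mulrDl -mulrDr !add_conj Er real_comm.
apply/eqP; rewrite mulrBr mulrA e2 [conjq a * (r * b)]mulrA e1 [in RHS]mulrBl e3.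
move: (conjq a * L) => W; rewrite !mulrBl !mulrDl mulrA.
move: (L * conjq b * b) (L * b * b) (r * b * b) (W * b) => U X Y Z.
by rewrite opprB [X + U]addrC addrA [U + _]addrA [LHS]addrAC.
Qed.

End Interpolants.

(** * Interpolants for a pair of equivalent nodes *)

Section Pairs.
Variable R : realType.
Local Notation H := (quat R).
Implicit Types (a b c d p x r g : H) (P Q : {poly H}).

Lemma conjq_conjugate p a : p != 0 ->
  conjq (p^-1 * a * p) = p^-1 * conjq a * p.
Proof.
move=> p0; have conjE x : conjq x = (2 * qre x)%:A - x.
  by rewrite -add_conj addrC addKr.
have /andP[/eqP Er _] := same_classJ a p0.
by rewrite !conjE Er mulrBr mulrBl -(real_comm _ p^-1) mulrVK ?unitqE.
Qed.

Lemma conj_mul_comm x : conjq x * x = x * conjq x.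
Proof. by apply: quat_eq => /=; ring. Qed.

(** Put f = P * (r - g)%:P * Q. The left value of f at a is twisted: it is the
    given discrepancy minus that of P * g%:P * Q. It is also the left value of
    (p * (r - g))%:P * Q, with p the value of P, whose right value at b is the
    element in question, and the difference of these two values is twisted. *)
Lemma twisted_difference P Q a b r g : same_class a b ->
  lhorner (P * r%:P * Q) a - (P * g%:P * Q).[b] \in twisted a b ->
  lhorner P a * (r - g) * Q.[b] \in twisted a b.
Proof.
move=> sab cd.
have tw_g := lhorner_sub_horner (P * g%:P * Q) sab.
have tw_a : lhorner (P * (r - g)%:P * Q) a \in twisted a b.
  rewrite (polyCB r g) (mulrBr P) (mulrBl Q) lhornerB.
  by have := twistedB cd tw_g; rewrite opprB addrA subrK.
have := lhorner_sub_horner ((lhorner P a * (r - g))%:P * Q) sab.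
rewrite hornerCM polyCM -(mulrA _%:P) -lhorner_mull (mulrA P) => tw.
by have := twistedB tw_a tw; rewrite subKr.
Qed.

(** The second summand has the left factor P * (X - t), so it does not affect
    the left value at a. With k its constant and v = Q.[b], the product rule
    shows that the right value at b is that of P * e%:P, where
      e = r * v + (k * v * b - t * k * v).
    By twisted_difference, r - g and hence k satisfy
    k * v * b = conjq t * k * v, so the bracket is
    - (t - conjq t) * k * v = - 2 Im(t) * k * v. The choice of k makes this
    (g - r) * v, and therefore e = g * v. *)
Lemma horner_pair P Q a b r g :
  let p := lhorner P a in let t := p^-1 * a * p in
  p != 0 -> same_class a b -> imq a != 0 ->
  lhorner (P * r%:P * Q) a - (P * g%:P * Q).[b] \in twisted a b ->
  (P * r%:P * Q
   + P * ('X - t%:P) * ((2 * imq t)^-1 * (r - g))%:P * Q).[b]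
  = (P * g%:P * Q).[b].
Proof.
move=> p t p0 sab a0 cd; set v := Q.[b].
have sat : same_class t a by exact: same_classJ.
have tw : conjq t * (r - g) * v = (r - g) * v * b.
  have := twisted_difference sab cd.
  rewrite -/p -/v unfold_in => /eqP tw.
  rewrite (conjq_conjugate _ p0); apply: (@mulrI _ p); first by rewrite unitqE.
  by rewrite !mulrA in tw *; rewrite -tw divrr ?unitqE // mul1r.
have im0 : 2 * imq t \is a GRing.unit.
  rewrite unitqE mulq_eq0 negb_or (same_class_im sat).2 a0 andbT.
  by apply/eqP => /(congr1 (@qre R)) /= /eqP; rewrite -[1 + 1]/(2%:R) pnatr_eq0.
move: t {sat} im0 tw => t U tw.
have comm_inv : conjq t * (2 * imq t)^-1 = (2 * imq t)^-1 * conjq t.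
  by apply: commrV; rewrite imq_conj /GRing.comm mulrBr mulrBl conj_mul_comm.
set ka := _^-1 * (r - g).
have ck : conjq t * ka * v = ka * v * b.
  rewrite /ka (mulrA (conjq t)) comm_inv.
  move: ((2 * imq t)^-1) => w.
  by rewrite -!(mulrA w) tw.
have dk : t * ka - conjq t * ka = r - g.
  by rewrite -mulrBl -imq_conj /ka (mulVKr U).
move: ka ck dk => {}ka ck dk.
rewrite horner_mul_add_XsubC horner_mulCm -/v -ck (mulrA t) -mulrBl.
by rewrite -opprB dk -mulrDl subKr.
Qed.

End Pairs.

(** * Nodes in a conjugacy class *)

Section Counting.
Variable R : realType.
Local Notation H := (quat R).
Implicit Types (a b x y : H) (S : {fset H}).

Definition class_of S a := [fset x in S | x \in conj_class a]%fset.

Lemma class_ofE S a x : (x \in class_of S a) = (x \in S) && same_class x a.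
Proof.
rewrite !inE /=; congr (_ && _); apply/idP/idP => [/set_mem/equivqP//|xa].
by apply/mem_set/equivqP.
Qed.

Lemma leq_class_of (s : seq H) S a : uniq s ->
  {in s, forall x, (x \in S) && same_class x a} ->
  (size s <= #|` class_of S a|)%N.
Proof. by move=> us sS; apply: uniq_leq_size => // x /sS; rewrite class_ofE. Qed.

Variables (n : nat) (alpha : 'I_n -> H).

Lemma mem_nodes i : alpha i \in nodes alpha.
Proof. by apply/imfsetP; exists i. Qed.

Lemma nodesP x : x \in nodes alpha -> exists i, x = alpha i.
Proof. by case/imfsetP => i _ ->; exists i. Qed.

Lemma mem_nodes_but i j : injective alpha ->
  (alpha j \in nodes_but alpha i) = (j != i).
Proof. by move=> ai; rewrite !inE mem_nodes (inj_eq ai) andbT. Qed.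

Lemma nodes_butU i : nodes alpha = (alpha i |` nodes_but alpha i)%fset.
Proof. by rewrite /nodes_but fsetD1K // mem_nodes. Qed.

Lemma nodes_but_class_uniq i :
  (#|` class_of (nodes alpha) (alpha i)| <= 2)%N ->
  {in nodes_but alpha i &, forall x y,
    same_class x (alpha i) -> same_class y (alpha i) -> x = y}.
Proof.
move=> le2 x y; rewrite !inE => /andP[xi xS] /andP[yi yS] sx sy.
apply/eqP; apply: contraLR le2 => xy; rewrite -ltnNge.
apply: (@leq_class_of [:: alpha i; x; y]).
  by rewrite /= !inE negb_or eq_sym xi eq_sym yi xy.
move=> z; rewrite !inE => /or3P[] /eqP->; rewrite ?xS ?yS ?sx ?sy //.
by rewrite mem_nodes /same_class !eqxx.
Qed.

Lemma nodes_but_class_free i a : same_class a (alpha i) ->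
  (#|` class_of (nodes alpha) a| <= 1)%N ->
  {in nodes_but alpha i, forall x, ~~ same_class x a}.
Proof.
move=> sa le1 x; rewrite !inE => /andP[xi xS].
apply: contraL le1 => sx; rewrite -ltnNge.
apply: (@leq_class_of [:: alpha i; x]); first by rewrite /= inE eq_sym xi.
move=> z; rewrite !inE => /orP[] /eqP->; rewrite ?xS ?sx //.
by rewrite mem_nodes same_class_sym.
Qed.

End Counting.

(** * The interpolation problem *)

Section Interpolation.
Variables (R : realType) (n m k : nat).
Local Notation H := (quat R).
Variables (alpha : 'I_n -> H) (beta : 'I_m -> H).
Hypotheses (alpha_inj : injective alpha) (beta_inj : injective beta).
Hypothesis beta_nonreal : forall j (x : R), beta j <> x%:A.
Hypothesis no_three : forall a : H,
  (#|` class_of (nodes alpha) a| + #|` class_of (nodes beta) a| <= 2)%N.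
Hypotheses (le_kn : (k <= n)%N) (le_km : (k <= m)%N).
Local Notation wn := (widen_ord le_kn).
Local Notation wm := (widen_ord le_km).
Hypothesis equiv_le_k : forall s : 'I_k, same_class (alpha (wn s)) (beta (wm s)).
Hypothesis alpha_gt_k : forall i : 'I_n, (k <= i)%N ->
  {in nodes beta, forall y, ~~ same_class y (alpha i)}.
Hypothesis beta_gt_k : forall j : 'I_m, (k <= j)%N ->
  {in nodes alpha, forall y, ~~ same_class y (beta j)}.

Local Notation PL := (lminpoly (nodes alpha)).
Local Notation PO := (rminpoly (nodes beta)).
Local Notation PLi i := (lminpoly (nodes_but alpha i)).
Local Notation POj j := (rminpoly (nodes_but beta j)).

Lemma lminpoly_but_neq0 i : lhorner (PLi i) (alpha i) != 0.
Proof.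
apply: lminpoly_neq0; first by rewrite mem_nodes_but ?eqxx.
apply: nodes_but_class_uniq; exact: leq_trans (leq_addr _ _) (no_three _).
Qed.

Lemma rminpoly_but_neq0 j : (POj j).[beta j] != 0.
Proof.
apply: rminpoly_neq0; first by rewrite mem_nodes_but ?eqxx.
apply: nodes_but_class_uniq; exact: leq_trans (leq_addl _ _) (no_three _).
Qed.

Lemma lminpoly_butE i : PL = PLi i * ('X - (alpha_tilde alpha i)%:P).
Proof. by rewrite {1}(nodes_butU alpha i) lminpolyU1 // lminpoly_but_neq0. Qed.

Lemma rminpoly_butE j : PO = ('X - (beta_tilde beta j)%:P) * POj j.
Proof. by rewrite {1}(nodes_butU beta j) rminpolyU1 // rminpoly_but_neq0. Qed.

Lemma class_size_gt0 p (x : 'I_p -> H) i a : same_class (x i) a ->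
  (1 <= #|` class_of (nodes x) a|)%N.
Proof.
move=> sa; apply: (@leq_class_of _ [:: x i]) => // z.
by rewrite inE => /eqP->; rewrite mem_nodes.
Qed.

Lemma rminpoly_but_norm_neq0 s :
  (conjp (POj (wm s)) * POj (wm s)).[alpha (wn s)] != 0.
Proof.
apply: rminpoly_norm_neq0; apply: nodes_but_class_free; first exact: equiv_le_k.
rewrite -(leq_add2l 1); apply: leq_trans (no_three (alpha (wn s))).
by rewrite leq_add2r (@class_size_gt0 _ _ (wn s)) // /same_class !eqxx.
Qed.

Lemma lminpoly_but_norm_neq0 s :
  (conjp (PLi (wn s)) * PLi (wn s)).[beta (wm s)] != 0.
Proof.
apply: lminpoly_norm_neq0; apply: nodes_but_class_free.
  by rewrite same_class_sym equiv_le_k.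
rewrite -(leq_add2r 1); apply: leq_trans (no_three (beta (wm s))).
by rewrite leq_add2l (@class_size_gt0 _ _ (wm s)) // /same_class !eqxx.
Qed.

Lemma lhorner_lminpoly i : lhorner PL (alpha i) = 0.
Proof. by apply: lminpoly_root; exact: mem_nodes. Qed.

Lemma horner_rminpoly j : PO.[beta j] = 0.
Proof. by apply: rminpoly_root; exact: mem_nodes. Qed.

Lemma lhorner_lminpoly_but i j : j != i -> lhorner (PLi i) (alpha j) = 0.
Proof. by move=> ji; apply: lminpoly_root; rewrite mem_nodes_but. Qed.

Lemma horner_rminpoly_but i j : j != i -> (POj i).[beta j] = 0.
Proof. by move=> ji; apply: rminpoly_root; rewrite mem_nodes_but. Qed.

Lemma imq_alpha_neq0 s : imq (alpha (wn s)) != 0.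
Proof.
rewrite (same_class_im (equiv_le_k s)).2; apply/eqP => im0.
apply: (@beta_nonreal (wm s) (qre (beta (wm s)))).
by apply/eqP; rewrite -subr_eq0 -im0.
Qed.

(** Equivalent nodes remain equivalent and nonreal after the conjugations that
    define the twisted nodes, so planeP applies. *)
Lemma plane_tilde s mu :
  plane (alpha_tilde alpha (wn s)) (beta_tilde beta (wm s)) mu <->
  alpha_tilde alpha (wn s) * mu = mu * beta_tilde beta (wm s).
Proof.
have sa : same_class (alpha_tilde alpha (wn s)) (alpha (wn s)).
  by apply: same_classJ; exact: lminpoly_but_neq0.
apply: planeP; last by rewrite (same_class_im sa).2 imq_alpha_neq0.
apply: same_class_trans sa _; apply: same_class_trans (equiv_le_k s) _.
rewrite same_class_sym /beta_tilde -{1}[(POj (wm s)).[_]]invrK.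
by apply: same_classJ; rewrite -unitqE unitrV unitqE rminpoly_but_neq0.
Qed.

Lemma lhorner_mulXsubC (q : {poly H}) t a :
  lhorner (q * ('X - t%:P)) a = a * lhorner q a - lhorner q a * t.
Proof. by rewrite mulrBr lhornerB lhornerMX lhornerMC. Qed.

Lemma lhorner_sumMC p (P : 'I_p -> {poly H}) (a : 'I_p -> H) x :
  lhorner (\sum_j P j * (a j)%:P) x = \sum_j lhorner (P j) x * a j.
Proof. by rewrite lhorner_sum; apply: eq_bigr => j _; rewrite lhornerMC. Qed.

Lemma lhorner_lagrange (a : 'I_n -> H) i :
  lhorner (\sum_j PLi j * (a j)%:P) (alpha i) = lhorner (PLi i) (alpha i) * a i.
Proof.
rewrite lhorner_sumMC (bigD1 i) //= big1 ?addr0 // => j ji.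
by rewrite lhorner_lminpoly_but 1?eq_sym // mul0r.
Qed.

(** The summation is the left Lagrange interpolant of q, so the difference
    vanishes on the nodes. *)
Lemma lagrange_left (q : {poly H}) : exists h : {poly H},
  q = \sum_i PLi i * ((lhorner (PLi i) (alpha i))^-1 * lhorner q (alpha i))%:P
      + PL * h.
Proof.
pose a i := (lhorner (PLi i) (alpha i))^-1 * lhorner q (alpha i).
have [x /nodesP[i ->]|h eh] :=
    @lminpoly_dvd R (nodes alpha) (q - \sum_i PLi i * (a i)%:P).
  by rewrite lhornerB lhorner_lagrange /a mulVKr ?subrr // unitqE lminpoly_but_neq0.
by exists h; rewrite -eh addrC subrK.
Qed.

Lemma sum_widen (V : nmodType) p (le_kp : (k <= p)%N) (F : 'I_p -> V) :
  (forall i : 'I_p, (k <= i)%N -> F i = 0) ->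
  \sum_i F i = \sum_(s < k) F (widen_ord le_kp s).
Proof.
move=> F0; rewrite (bigID (fun i : 'I_p => (i < k)%N)) /= big_ord_narrow.
by rewrite [X in _ + X]big1 ?addr0 // => i; rewrite -leqNgt => /F0.
Qed.

(** A solution is q * PO by the right conditions. Lagrange interpolation of q
    on the left gives constants mu_i, and each left condition on q * PO then
    restricts mu_i alone. A node without equivalent partner makes the norm of
    PO invertible, which forces mu_i = 0. For a paired node, PO = (X - t) *
    POj with the norm of POj invertible; cancelling POj leaves the condition
    that mu_i intertwines the twisted nodes, which is membership in the plane. *)
Lemma homogeneousP (g : {poly H}) :
  ((forall i, lhorner g (alpha i) = 0) /\ (forall j, g.[beta j] = 0)) <->
  exists (mu : 'I_k -> H) (h : {poly H}),
    (forall s, plane (alpha_tilde alpha (wn s)) (beta_tilde beta (wm s)) (mu s))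
    /\ g = \sum_(s < k) PLi (wn s) * (mu s)%:P * PO + PL * h * PO.
Proof.
split=> [[ga gb]|[mu [h [mu_plane ->]]]]; last first.
  split=> [i|j]; last first.
    rewrite hornerD horner_sum big1 ?add0r => [|s _];
      by rewrite horner_mulr0 // horner_rminpoly.
  rewrite lhornerD lhorner_sum -(mulrA PL).
  rewrite (lhorner_mull0 _ (lhorner_lminpoly i)) addr0.
  apply: big1 => s _; have [->|ne] := eqVneq i (wn s); last first.
    by apply/lhorner_mull0/lhorner_mull0; rewrite lhorner_lminpoly_but.
  have /plane_tilde e := mu_plane s.
  rewrite (rminpoly_butE (wm s)) (mulrA _ ('X - _)); apply: lhorner_mull0.
  rewrite lhorner_mulXsubC lhornerMC -mulrA -e /alpha_tilde !mulrA.
  by rewrite divrr ?unitqE ?lminpoly_but_neq0 // mul1r subrr.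
have [x /nodesP[j ->]//|q eg] := @rminpoly_dvd R (nodes beta) g.
have [h eq] := lagrange_left q.
pose mu i := (lhorner (PLi i) (alpha i))^-1 * lhorner q (alpha i).
exists (fun s => mu (wn s)), h; split=> [s|].
  apply/plane_tilde.
  have := ga (wn s); rewrite eg (rminpoly_butE (wm s)) mulrA.
  move/(lhorner_cancelr (rminpoly_monic _) (rminpoly_but_norm_neq0 s))/eqP.
  rewrite lhorner_mulXsubC subr_eq0 => /eqP e.
  by rewrite /alpha_tilde /mu -!mulrA mulVKr ?unitqE ?lminpoly_but_neq0 // e.
rewrite eg {1}eq mulrDl mulr_suml; congr (_ + _).
apply: (@sum_widen _ _ le_kn) => i le_ki.
have q0 : lhorner q (alpha i) = 0.
  have := ga i; rewrite eg; apply: lhorner_cancelr; first exact: rminpoly_monic.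
  by apply: rminpoly_norm_neq0; exact: alpha_gt_k.
have -> : (lhorner (PLi i) (alpha i))^-1 * lhorner q (alpha i) = 0.
  by rewrite q0 mulr0.
by rewrite polyC0 (mulr0 (PLi i)) mul0r.
Qed.

Variables (c : 'I_n -> H) (d : 'I_m -> H).
Hypothesis compat : forall s : 'I_k,
  c (wn s) - d (wm s) \in twisted (alpha (wn s)) (beta (wm s)).

Lemma lhorner_f_left (i i' : 'I_n) : (k <= i)%N ->
  lhorner (f_left alpha beta c i) (alpha i') = if i' == i then c i else 0.
Proof.
move=> le_ki; rewrite /f_left; case: eqVneq => [->|ne]; last first.
  by apply/lhorner_mull0/lhorner_mull0; rewrite lhorner_lminpoly_but.
apply: lhorner_rho; [exact: rminpoly_monic|exact: lminpoly_but_neq0|].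
by apply: rminpoly_norm_neq0; exact: alpha_gt_k.
Qed.

Lemma horner_f_left i j : (f_left alpha beta c i).[beta j] = 0.
Proof. by rewrite /f_left horner_mulr0 // horner_rminpoly. Qed.

Lemma horner_f_right (j j' : 'I_m) : (k <= j)%N ->
  (f_right alpha beta d j).[beta j'] = if j' == j then d j else 0.
Proof.
move=> le_kj; rewrite /f_right; case: eqVneq => [->|ne]; last first.
  by rewrite horner_mulr0 // horner_rminpoly_but.
apply: horner_gamma; [exact: lminpoly_monic|exact: rminpoly_but_neq0|].
by apply: lminpoly_norm_neq0; exact: beta_gt_k.
Qed.

Lemma lhorner_f_right j i : lhorner (f_right alpha beta d j) (alpha i) = 0.
Proof. by apply/lhorner_mull0/lhorner_mull0; rewrite lhorner_lminpoly. Qed.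

Lemma lhorner_f_pair s i :
  lhorner (f_pair alpha beta c d (wn s) (wm s)) (alpha i)
  = if i == wn s then c (wn s) else 0.
Proof.
rewrite /f_pair lhornerD [X in _ + X](_ : _ = 0) ?addr0; last first.
  by apply/lhorner_mull0/lhorner_mull0; rewrite lhorner_lminpoly.
case: eqVneq => [->|ne]; last first.
  by apply/lhorner_mull0/lhorner_mull0; rewrite lhorner_lminpoly_but.
apply: lhorner_rho; [exact: rminpoly_monic|exact: lminpoly_but_neq0|].
exact: rminpoly_but_norm_neq0.
Qed.

Lemma horner_f_pair s j :
  (f_pair alpha beta c d (wn s) (wm s)).[beta j]
  = if j == wm s then d (wm s) else 0.
Proof.
rewrite /f_pair; cbv zeta.
set r := rho _ _ _ _; set g := gamma _ _ _ _.
case: eqVneq => [e|ne]; last first.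
  rewrite hornerD -[RHS]addr0; congr (_ + _); apply: horner_mulr0;
    exact: horner_rminpoly_but.
rewrite {}e.
have er : lhorner (PLi (wn s) * r%:P * POj (wm s)) (alpha (wn s)) = c (wn s).
  apply: lhorner_rho; [exact: rminpoly_monic|exact: lminpoly_but_neq0|].
  exact: rminpoly_but_norm_neq0.
have eg : (PLi (wn s) * g%:P * POj (wm s)).[beta (wm s)] = d (wm s).
  apply: horner_gamma; [exact: lminpoly_monic|exact: rminpoly_but_neq0|].
  exact: lminpoly_but_norm_neq0.
move: (r) (g) er eg => {}r {}g er eg.
rewrite (lminpoly_butE (wn s)) -[RHS]eg; apply: horner_pair.
- exact: lminpoly_but_neq0.
- exact: equiv_le_k.
- exact: imq_alpha_neq0.
- by rewrite er eg; exact: compat.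
Qed.

Lemma sum_delta p (le_kp : (k <= p)%N) (u : 'I_p -> H) i :
  \sum_(i' < p | (k <= i')%N) (if i == i' then u i' else 0)
  + \sum_(s < k) (if i == widen_ord le_kp s then u (widen_ord le_kp s) else 0)
  = u i.
Proof.
have <- : \sum_i' (if i == i' then u i' else 0) = u i.
  by rewrite (bigD1 i) //= eqxx big1 ?addr0 // => j /negPf ji; rewrite eq_sym ji.
rewrite [RHS](bigID (fun i' : 'I_p => (i' < k)%N)) /= big_ord_narrow addrC.
by congr (_ + _); apply: eq_bigl => i'; rewrite leqNgt.
Qed.

Definition particular : {poly H} :=
  \sum_(i < n | (k <= i)%N) f_left alpha beta c i
  + \sum_(j < m | (k <= j)%N) f_right alpha beta d j
  + \sum_(s < k) f_pair alpha beta c d (wn s) (wm s).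

Lemma lhorner_particular i : lhorner particular (alpha i) = c i.
Proof.
rewrite !lhornerD !lhorner_sum -[RHS](sum_delta le_kn).
rewrite [X in _ + X + _]big1 ?addr0 => [|j _]; last exact: lhorner_f_right.
by congr (_ + _); apply: eq_bigr => i' ?; rewrite ?lhorner_f_left ?lhorner_f_pair.
Qed.

Lemma horner_particular j : particular.[beta j] = d j.
Proof.
rewrite !hornerD !horner_sum -[RHS](sum_delta le_km).
rewrite [X in X + _ + _]big1 ?add0r => [|i _]; last exact: horner_f_left.
by congr (_ + _); apply: eq_bigr => i' ?; rewrite ?horner_f_right ?horner_f_pair.
Qed.

Lemma interpolationP (f : {poly H}) :
  ((forall i, lhorner f (alpha i) = c i) /\ (forall j, f.[beta j] = d j)) <->
  exists (mu : 'I_k -> H) (h : {poly H}),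
    (forall s, plane (alpha_tilde alpha (wn s)) (beta_tilde beta (wm s)) (mu s))
    /\ f = particular
           + \sum_(s < k) PLi (wn s) * (mu s)%:P * PO + PL * h * PO.
Proof.
have <- : ((forall i, lhorner (f - particular) (alpha i) = 0) /\
           (forall j, (f - particular).[beta j] = 0)) <->
    ((forall i, lhorner f (alpha i) = c i) /\ (forall j, f.[beta j] = d j)).
  have ha i : lhorner (f - particular) (alpha i) = lhorner f (alpha i) - c i.
    by rewrite lhornerB lhorner_particular.
  have hb j : (f - particular).[beta j] = f.[beta j] - d j.
    by rewrite hornerD hornerN horner_particular.
  split=> -[fa fb]; split=> x.
  - by apply/eqP; rewrite -subr_eq0 -ha fa.
  - by apply/eqP; rewrite -subr_eq0 -hb fb.
  - by rewrite ha fa subrr.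
  - by rewrite hb fb subrr.
rewrite homogeneousP; split=> -[mu [h [mu_plane e]]]; exists mu, h; split=> //.
  by rewrite -addrA -e addrC subrK.
by rewrite e -(addrA particular) (addrC particular) addrK.
Qed.

End Interpolation.
Theorem theorem5p9 (R : realType) (n m k : nat)
    (alpha : 'I_n -> quat R) (beta : 'I_m -> quat R)
    (c : 'I_n -> quat R) (d : 'I_m -> quat R)
    (alpha_inj : injective alpha) (beta_inj : injective beta)
    (beta_nonreal : forall (j : 'I_m) (x : R), beta j <> x%:A)
    (no_three : forall a : quat R,
       (#|` [fset x in nodes alpha | x \in conj_class a]%fset|
        + #|` [fset x in nodes beta | x \in conj_class a]%fset| <= 2)%N)
    (le_kn : (k <= n)%N) (le_km : (k <= m)%N)
    (equiv_le_k : forall s : 'I_k,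
       equivq (alpha (widen_ord le_kn s)) (beta (widen_ord le_km s)))
    (alpha_gt_k : forall i : 'I_n, (k <= i)%N ->
       forall y : quat R, y \in nodes beta -> ~ conj_class (alpha i) y)
    (beta_gt_k : forall j : 'I_m, (k <= j)%N ->
       forall y : quat R, y \in nodes alpha -> ~ conj_class (beta j) y)
    (compat : forall s : 'I_k,
       let i := widen_ord le_kn s in let j := widen_ord le_km s in
       conjq (alpha i) * (c i - d j) = (c i - d j) * beta j)
    (f : {poly quat R}) :
  ((forall i : 'I_n, lhorner f (alpha i) = c i) /\
   (forall j : 'I_m, f.[beta j] = d j))
  <->
  exists (mu : 'I_k -> quat R) (h : {poly quat R}),
    (forall s : 'I_k,
       plane (alpha_tilde alpha (widen_ord le_kn s))
             (beta_tilde beta (widen_ord le_km s)) (mu s)) /\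
    f = \sum_(i < n | (k <= i)%N) f_left alpha beta c i
        + \sum_(j < m | (k <= j)%N) f_right alpha beta d j
        + \sum_(s < k) f_pair alpha beta c d
                         (widen_ord le_kn s) (widen_ord le_km s)
        + \sum_(s < k) lminpoly (nodes_but alpha (widen_ord le_kn s))
                         * (mu s)%:P * rminpoly (nodes beta)
        + lminpoly (nodes alpha) * h * rminpoly (nodes beta).
Proof.
apply: interpolationP => //.
- by move=> s; apply/equivqP.
- by move=> i le_ki y yO; apply/negP => /equivqP; apply: alpha_gt_k.
- by move=> j le_kj y yL; apply/negP => /equivqP; apply: beta_gt_k.
- by move=> s; apply/eqP; exact: compat.
Qed.
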